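(* Let $f:\mathbb{R}^n\to[0,\infty)$ be a bounded function and $u_0:\mathbb{R}^n\to[0,\infty)$ a continuous function such that $\operatorname{supp}u_0,\ \operatorname{supp}f\subset B(0,R)$ for some $R>0$. Then there exists a unique maximal viscosity solution $u$ of $$u_t-\left(\operatorname{div}\left(\frac{Du}{|Du|}\right)+1\right)|Du|=f(x)\ \text{ in }\mathbb{R}^n\times(0,\infty),\qquad u(\cdot,0)=u_0\ \text{ on }\mathbb{R}^n .$$
   Context: $B(x,R)$ is the open ball of radius $R$ centered at $x$. Viscosity solutions. Let $\mathbb{S}^n$ be the real symmetric $n\times n$ matrices. For $p\in\mathbb{R}^n\setminus\{0\}$, $X\in\mathbb{S}^n$ put $\sigma(p)=I-(p\otimes p)/|p|^2$ and $H(p,X)=-\operatorname{tr}[\sigma(p)X]-|p|$; $H_*$, $H^*$ denote the lower and upper semicontinuous envelopes of $H$ on $\mathbb{R}^n\times\mathbb{S}^n$. In general $h^*$, $h_*$ denote the upper and lower semicontinuous envelopes of a locally bounded function $h$. A locally bounded $u:\mathbb{R}^n\times[0,\infty)\to\mathbb{R}$ is a viscosity subsolution of the problem if $u^*(\cdot,0)\le u_0$ and $\tau+H_*(p,X)\le f^*(x_0)$ for all $(x_0,t_0)\in\mathbb{R}^n\times(0,\infty)$ and $(p,X,\tau)\in J^+u^*(x_0,t_0)$; it is a viscosity supersolution if $u_*(\cdot,0)\ge u_0$ and $\tau+H^*(p,X)\ge f_*(x_0)$ for all $(x_0,t_0)\in\mathbb{R}^n\times(0,\infty)$ and $(p,X,\tau)\in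 J^-u_*(x_0,t_0)$; it is a viscosity solution if it is both. Here $J^\pm$ are the parabolic super/sub semijets: $(p,X,\tau)\in J^+v(x_0,t_0)$ iff $v(x,t)\le v(x_0,t_0)+\tau(t-t_0)+p\cdot(x-x_0)+\frac12X(x-x_0)\cdot(x-x_0)+o(|t-t_0|+|x-x_0|^2)$ as $(x,t)\to(x_0,t_0)$, and $J^-v=-J^+(-v)$. A function $u$ is called compactly supported in space if for every $T>0$ there is $R_T>0$ with $u(x,t)=0$ for $x\notin B(0,R_T)$, $t\in[0,T]$. A maximal viscosity solution is a viscosity solution $u$, compactly supported in space, such that $u\ge v$ on $\mathbb{R}^n\times[0,\infty)$ for every viscosity solution $v$ compactly supported in space. *)

(* Defs.v *)
From mathcomp Require Import all_boot all_order all_algebra.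
From mathcomp Require Import all_classical all_reals all_analysis.
Set Implicit Arguments.
Unset Strict Implicit.
Unset Printing Implicit Defensive.
Import Order.TTheory GRing.Theory Num.Theory.
Import numFieldNormedType.Exports.
Local Open Scope classical_set_scope.
Local Open Scope ring_scope.

(* The norm `|x| of the library on 'rV[R]_n is the sup norm (it induces the same
   topology), hence the explicit Euclidean norm. *)
Definition enorm (R : realType) (n : nat) (x : 'rV[R]_n) : R :=
  Num.sqrt (\sum_i x 0 i ^+ 2).

Definition eball (R : realType) (n : nat) (x : 'rV[R]_n) (r : R) : set 'rV[R]_n :=
  [set y | enorm (y - x) < r].

Definition supp (R : realType) (n : nat) (g : 'rV[R]_n -> R) : set 'rV[R]_n :=
  closure [set x | g x != 0].

(* Envelopes of a function h defined on D, at points of the closure of D: the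
   punctured limit is not taken, i.e. h x itself counts when x is in D.  The
   limsup and liminf are finite, so that fine is harmless, as soon as h is
   bounded on the intersection of D with a neighborhood of x. *)
Definition usc_env (R : realType) (T : topologicalType) (D : set T) (h : T -> R)
    (x : T) : R :=
  fine (limf_esup (EFin \o h) (within D (nbhs x))).

Definition lsc_env (R : realType) (T : topologicalType) (D : set T) (h : T -> R)
    (x : T) : R :=
  fine (limf_einf (EFin \o h) (within D (nbhs x))).

Definition sigma (R : realType) (n : nat) (p : 'rV[R]_n) : 'M[R]_n :=
  1%:M - (enorm p ^+ 2)^-1 *: (p^T *m p).

Definition Hdom (R : realType) (n : nat) : set ('rV[R]_n * 'M[R]_n) :=
  [set a | a.1 != 0 /\ a.2^T = a.2].

Definition H (R : realType) (n : nat) (a : 'rV[R]_n * 'M[R]_n) : R :=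
  - \tr (sigma a.1 *m a.2) - enorm a.1.

Definition Hlow (R : realType) (n : nat) : 'rV[R]_n * 'M[R]_n -> R :=
  lsc_env (@Hdom R n) (@H R n).

Definition Hup (R : realType) (n : nat) : 'rV[R]_n * 'M[R]_n -> R :=
  usc_env (@Hdom R n) (@H R n).

(* Functions on R^n x [0, oo) are total functions on 'rV[R]_n * R whose values
   at negative times are never looked at. *)
Definition spacetime (R : realType) (n : nat) : set ('rV[R]_n * R) :=
  [set z | 0 <= z.2].

(* Triples (p, X, tau); the little-o is spelled out with epsilons. *)
Definition Jplus (R : realType) (n : nat) (v : 'rV[R]_n * R -> R)
    (z0 : 'rV[R]_n * R) : set ('rV[R]_n * 'M[R]_n * R) :=
  [set j | let: (p, X, tau) := j in
    X^T = X /\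
    forall eps : R, 0 < eps ->
      \forall z \near z0,
        let dx := z.1 - z0.1 in
        let dt := z.2 - z0.2 in
        v z <= v z0 + tau * dt + (p *m dx^T) 0 0
               + 2^-1 * (dx *m X *m dx^T) 0 0
               + eps * (`|dt| + enorm dx ^+ 2)].

Definition Jminus (R : realType) (n : nat) (v : 'rV[R]_n * R -> R)
    (z0 : 'rV[R]_n * R) : set ('rV[R]_n * 'M[R]_n * R) :=
  -%R @` Jplus (\- v) z0.

Definition locally_bounded (R : realType) (n : nat) (u : 'rV[R]_n * R -> R) : Prop :=
  forall z, spacetime z -> bounded_near u (within (@spacetime R n) (nbhs z)).

Definition subsolution (R : realType) (n : nat) (f u0 : 'rV[R]_n -> R)
    (u : 'rV[R]_n * R -> R) : Prop :=
  let us := usc_env (@spacetime R n) u in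
  [/\ locally_bounded u,
      forall x, us (x, 0) <= u0 x &
      forall x0 t0, 0 < t0 -> forall p X tau, Jplus us (x0, t0) (p, X, tau) ->
        tau + Hlow (p, X) <= usc_env setT f x0].

Definition supersolution (R : realType) (n : nat) (f u0 : 'rV[R]_n -> R)
    (u : 'rV[R]_n * R -> R) : Prop :=
  let ul := lsc_env (@spacetime R n) u in
  [/\ locally_bounded u,
      forall x, u0 x <= ul (x, 0) &
      forall x0 t0, 0 < t0 -> forall p X tau, Jminus ul (x0, t0) (p, X, tau) ->
        lsc_env setT f x0 <= tau + Hup (p, X)].

Definition viscosity_solution (R : realType) (n : nat) (f u0 : 'rV[R]_n -> R)
    (u : 'rV[R]_n * R -> R) : Prop :=
  subsolution f u0 u /\ supersolution f u0 u.

Definition compactly_supported_in_space (R : realType) (n : nat)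
    (u : 'rV[R]_n * R -> R) : Prop :=
  forall T : R, 0 < T -> exists2 RT : R, 0 < RT &
    forall x t, ~ eball 0 RT x -> 0 <= t <= T -> u (x, t) = 0.

Definition maximal_viscosity_solution (R : realType) (n : nat)
    (f u0 : 'rV[R]_n -> R) (u : 'rV[R]_n * R -> R) : Prop :=
  [/\ viscosity_solution f u0 u,
      compactly_supported_in_space u &
      forall v, viscosity_solution f u0 v -> compactly_supported_in_space v ->
        forall z, spacetime z -> v z <= u z].

(* Main.v *)
Require Import Defs.
From mathcomp Require Import all_boot all_order all_algebra.
From mathcomp Require Import all_classical all_reals all_analysis.
From mathcomp Require Import lra ring.
Set Implicit Arguments.
Unset Strict Implicit.
Unset Printing Implicit Defensive.
Import Order.TTheory GRing.Theory Num.Theory.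
Import numFieldNormedType.Exports.
Local Open Scope classical_set_scope.
Local Open Scope ring_scope.

(** The maximal solution is the supremum of all the subsolutions with compact
support in space (Perron's method). As f may be discontinuous, subsolutions
cannot be compared with arbitrary supersolutions; but they only have to be
compared with explicit smooth barriers (lemma comparison), and for this the
barrier itself serves as test function at a maximum point of the difference.

Two families of barriers bound the supremum from above. A profile moving with
speed 2 along a coordinate axis is a supersolution, because its level sets are
hyperplanes and a flat front moves with speed 1 (wave_barrier): hence all the
subsolutions vanish outside a common cube up to each time (admissible_support),
and the supremum is finite and has compact support in space. A paraboloid which
touches the initial datum from above up to eps and grows fast in time bounds
the upper envelope of the supremum at time 0 (admissible_initial_bound). From
below, sinking paraboloids truncated at 0 are themselves members of the family
(parabola_admissible), so that the lower envelope at time 0 is at least the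
initial datum.

Inside, the supremum is a subsolution because a near-maximiser touches a
slightly perturbed test function at a nearby point (sup_subsolution), and it is
a supersolution because otherwise it could be raised locally and would not be
the supremum (maximal_supersolution). A solution with compact support is in
particular a member of the family, so the supremum is maximal. Two maximal
solutions lie below each other, which is uniqueness. *)

(** * Semicontinuous envelopes *)

Section Envelopes.
Context {R : realType} {T : topologicalType}.
Implicit Types (D : set T) (h : T -> R) (x : T) (c : R).

Lemma within_closure_proper D x : closure D x -> ProperFilter (within D (nbhs x)).
Proof.
move=> clDx; split; last exact: within_filter.
by rewrite /within /= => /clDx [y [Dy]] /(_ Dy).
Qed.

Lemma usc_env_fin_num D h x : closure D x ->
  bounded_near h (within D (nbhs x)) ->
  limf_esup (EFin \o h) (within D (nbhs x)) \is a fin_num.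
Proof.
move=> /within_closure_proper PF /ex_bound[M hM].
rewrite limf_esupE fin_numElt; apply/andP; split.
  apply: (@lt_le_trans _ _ (- M)%:E); first exact: ltNyr.
  apply: le_ereal_inf_tmp => _ [V FV <-].
  have [y [Vy /= hy]] := filter_ex (filterI FV hM).
  apply: le_ereal_sup_tmp; exists (h y)%:E; first by exists y.
  by rewrite lee_fin; move: hy; rewrite ler_norml => /andP[].
apply: (@le_lt_trans _ _ M%:E); last exact: ltry.
apply: ge_ereal_inf; exists (ereal_sup ((EFin \o h) @` [set y | `|h y| <= M])).
  by exists [set y | `|h y| <= M].
apply: ge_ereal_sup => _ [y /= hy <-].
by rewrite lee_fin; move: hy; rewrite ler_norml => /andP[].
Qed.

(** Together with usc_env_le this characterises the upper envelope by
neighborhoods; limits superior do not appear any more after these two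
lemmas. *)
Lemma usc_env_lt D h x c : closure D x ->
  bounded_near h (within D (nbhs x)) -> usc_env D h x < c ->
  \forall y \near within D (nbhs x), h y < c.
Proof.
move=> clDx bh; have := usc_env_fin_num clDx bh; rewrite /usc_env.
move=> fin ltc.
have : (limf_esup (EFin \o h) (within D (nbhs x)) < c%:E)%E.
  by rewrite -(fineK fin) lte_fin.
rewrite limf_esupE => /ereal_inf_lt[_ [V FV <-] supV].
apply: filterS FV => y Vy; rewrite -lte_fin; apply: le_lt_trans supV.
by apply: ereal_sup_ubound; exists y.
Qed.

Lemma usc_env_le D h x c : closure D x ->
  bounded_near h (within D (nbhs x)) ->
  (\forall y \near within D (nbhs x), h y <= c) -> usc_env D h x <= c.
Proof.
move=> clDx bh hc; have fin := usc_env_fin_num clDx bh; rewrite /usc_env.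
rewrite -lee_fin fineK// limf_esupE.
apply: ge_ereal_inf; exists (ereal_sup ((EFin \o h) @` [set y | h y <= c])).
  by exists [set y | h y <= c].
by apply: ge_ereal_sup => _ [y /= hy <-]; rewrite lee_fin.
Qed.

Lemma usc_env_ge D h x c : closure D x ->
  bounded_near h (within D (nbhs x)) ->
  (\forall y \near within D (nbhs x), c <= h y) -> c <= usc_env D h x.
Proof.
move=> clDx bh hc; rewrite leNgt; apply/negP => /(usc_env_lt clDx bh) hlt.
have PF := within_closure_proper clDx.
by have [y [/= cy yc]] := filter_ex (filterI hc hlt); move: (lt_le_trans yc cy); rewrite ltxx.
Qed.

Lemma usc_env_ub D h x : D x ->
  bounded_near h (within D (nbhs x)) -> h x <= usc_env D h x.
Proof.
move=> Dx bh; have clDx : closure D x by exact: subset_closure.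
rewrite leNgt; apply/negP => /(usc_env_lt clDx bh) /nbhs_singleton /(_ Dx).
by rewrite ltxx.
Qed.

Lemma usc_env_mono D h h' x : closure D x ->
  bounded_near h (within D (nbhs x)) ->  bounded_near h' (within D (nbhs x)) ->
  (\forall y \near within D (nbhs x), h y <= h' y) ->
  usc_env D h x <= usc_env D h' x.
Proof.
move=> clDx bh bh' hh'; rewrite leNgt; apply/negP => lt.
have [c /andP[c1 c2]] : exists c, usc_env D h' x < c < usc_env D h x.
  by exists ((usc_env D h' x + usc_env D h x) / 2); rewrite !midf_lt.
move: c2; rewrite ltNge => /negP; apply; apply: usc_env_le => //.
near=> y; apply: ltW.
apply: (@le_lt_trans _ _ (h' y)); first by near: y.
by near: y; exact: usc_env_lt.
Unshelve. all: by end_near. Qed.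

(** A neighborhood on which h < c is also a neighborhood of each of its interior
points, so the bound passes to the envelope there: the envelope is upper
semicontinuous. *)
Lemma usc_env_near D h x c :
  (forall y, closure D y -> bounded_near h (within D (nbhs y))) ->
  closure D x -> usc_env D h x < c ->
  \forall y \near within (closure D) (nbhs x), usc_env D h y < c.
Proof.
move=> bh clDx ltc.
have c1 : usc_env D h x < (usc_env D h x + c) / 2 by rewrite midf_lt.
have c2 : (usc_env D h x + c) / 2 < c by rewrite midf_lt.
have /near_join := usc_env_lt clDx (bh _ clDx) c1.
rewrite near_withinE; apply: filterS => y hy cly.
apply: le_lt_trans c2; apply: usc_env_le => //; first exact: bh.
by apply: filterS hy => z hz /hz /ltW.
Qed.

(** The lower envelope is the upper envelope of the opposite function, so that
only the upper one needs a theory. *)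
Lemma lsc_envE D h x : lsc_env D h x = - usc_env D (\- h) x.
Proof. by rewrite /lsc_env /limf_einf fineN. Qed.

End Envelopes.

Section ContinuousBounds.
Context {R : realType} {T : topologicalType}.
Implicit Types (D : set T) (h g : T -> R) (x : T).

Lemma bounded_near_le D h g x : {for x, continuous g} ->
  (\forall y \near within D (nbhs x), `|h y| <= g y) ->
  bounded_near h (within D (nbhs x)).
Proof.
move=> gc hg.
have gle : \forall y \near within D (nbhs x), g y < g x + 1.
  by apply: cvg_within; apply: (cvgr_lt _ gc); rewrite ltrDl.
rewrite /bounded_near; near=> N => /=.
near=> y => /=; apply: (@le_trans _ _ (g y)); first by near: y.
apply: (@le_trans _ _ (g x + 1)); last by near: N; apply: nbhs_pinfty_ge; exact: num_real.
by apply: ltW; near: y.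
Unshelve. all: by end_near. Qed.

Lemma usc_env_le_continuous D h g x : closure D x ->
  bounded_near h (within D (nbhs x)) -> {for x, continuous g} ->
  (\forall y \near within D (nbhs x), h y <= g y) -> usc_env D h x <= g x.
Proof.
move=> clDx bh gc hg; apply/ler_addgt0Pr => e e0.
apply: usc_env_le => //.
have gle : \forall y \near within D (nbhs x), g y < g x + e.
  by apply: cvg_within; apply: (cvgr_lt _ gc); rewrite ltrDl.
by apply: filterS2 hg gle => y h1 /ltW h2; exact: le_trans h1 h2.
Qed.

End ContinuousBounds.

(** The sets of reals above a value of g on K generate a filter; if no value
were maximal, compactness would push all the values strictly below one of
them. *)
Lemma usc_compact_max (R : realType) (T : topologicalType) (K : set T)
    (g : T -> R) : compact K -> K !=set0 ->
  (forall x c, K x -> g x < c -> \forall y \near x, K y -> g y < c) ->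
  exists2 x, K x & forall y, K y -> g y <= g x.
Proof.
move=> /compact_near_coveringP/near_covering_withinP cK [x0 Kx0] uscg.
apply: contrapT => nomax.
have above x : K x -> exists2 y, K y & g x < g y.
  move=> Kx; apply: contrapT => H0; apply: nomax; exists x => // y Ky.
  by rewrite leNgt; apply/negP => xy; apply: H0; exists y.
pose F := filter_from K (fun y => [set c : R | g y <= c]).
have FF : Filter F.
  apply: filter_from_filter; first by exists x0.
  move=> y z Ky Kz; exists (if g y <= g z then z else y); first by case: ifP.
  case: ifPn => [yz c /= zc|]; first by split=> //=; apply: le_trans zc.
  by rewrite -ltNge => /ltW zy c /= yc; split=> //=; apply: le_trans yc.
have [|y Ky /(_ (g y) (lexx _) y Ky)] := cK R F (fun c x => g x < c) FF; last first.
  by rewrite ltxx.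
move=> x Kx; have [y Ky gxy] := above x Kx.
exists ([set x' | K x' -> g x' < g y], [set c | g y <= c]).
  by split; [exact: uscg|exists y].
by move=> [x' c] [/= xy yc] Kx'; apply: lt_le_trans yc; exact: xy.
Qed.

(** * Euclidean vectors and quadratic forms *)

Lemma mx_cvg (R : realType) (n m : nat) (T : Type) (F : set_system T)
    {FF : Filter F} (g : T -> 'M[R]_(m, n)) (A : 'M[R]_(m, n)) :
  (forall i j, g x i j @[x --> F] --> A i j) -> g x @[x --> F] --> A.
Proof.
move=> gA B [P AP PB]; apply: filterS (PB) _.
have : \forall x \near F, forall i j, P i j (g x i j).
  by apply: filter_forall => i; apply: filter_forall => j; exact: gA.
by [].
Qed.

Lemma sum_continuous (R : realType) (T : topologicalType) (I : Type)
    (r : seq I) (g : I -> T -> R) : (forall i, continuous (g i)) ->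
  continuous (fun x => \sum_(i <- r) g i x).
Proof.
move=> gc; apply: (@continuous_big R I +%R 0 xpredT) => [|i _]; last exact: gc.
exact: add_continuous.
Qed.

Section Vectors.
Context {R : realType} {n : nat}.
Implicit Types (x y p : 'rV[R]_n) (X Y : 'M[R]_n).

Definition dot p x : R := (p *m x^T) 0 0.
Definition qform X x : R := (x *m X *m x^T) 0 0.
Definition nsq x : R := enorm x ^+ 2.

Lemma nsqE x : nsq x = \sum_i x 0 i ^+ 2.
Proof. by rewrite /nsq /enorm sqr_sqrtr// sumr_ge0// => i _; rewrite sqr_ge0. Qed.

Lemma dotE p x : dot p x = \sum_i p 0 i * x 0 i.
Proof. by rewrite /dot mxE; apply: eq_bigr => i _; rewrite mxE. Qed.

Lemma nsq_dot x : nsq x = dot x x.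
Proof. by rewrite nsqE dotE; apply: eq_bigr => i _; rewrite expr2. Qed.

Lemma enorm_ge0 x : 0 <= enorm x.
Proof. exact: sqrtr_ge0. Qed.

Lemma nsq_ge0 x : 0 <= nsq x.
Proof. exact: sqr_ge0. Qed.

Lemma enorm_sqrt x : enorm x = Num.sqrt (nsq x).
Proof. by rewrite /nsq sqrtr_sqr ger0_norm// enorm_ge0. Qed.

Lemma dotDl p q x : dot (p + q) x = dot p x + dot q x.
Proof. by rewrite /dot mulmxDl mxE. Qed.
Lemma dotNl p x : dot (- p) x = - dot p x.
Proof. by rewrite /dot mulNmx mxE. Qed.
Lemma dotZl a p x : dot (a *: p) x = a * dot p x.
Proof. by rewrite /dot -scalemxAl mxE. Qed.
Lemma dotC x y : dot x y = dot y x.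
Proof. by rewrite !dotE; apply: eq_bigr => i _; rewrite mulrC. Qed.
Lemma dotDr p x y : dot p (x + y) = dot p x + dot p y.
Proof. by rewrite dotC dotDl !(dotC p). Qed.
Lemma dotNr p x : dot p (- x) = - dot p x.
Proof. by rewrite dotC dotNl dotC. Qed.
Lemma dotZr a p x : dot p (a *: x) = a * dot p x.
Proof. by rewrite dotC dotZl dotC. Qed.
Lemma dot0l x : dot 0 x = 0.
Proof. by rewrite /dot mul0mx mxE. Qed.
Lemma dot0r x : dot x 0 = 0.
Proof. by rewrite dotC dot0l. Qed.

Lemma qform_dot X x : qform X x = dot (x *m X) x.
Proof. by []. Qed.
Lemma qformD X Y x : qform (X + Y) x = qform X x + qform Y x.
Proof. by rewrite !qform_dot mulmxDr dotDl. Qed.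
Lemma qformN X x : qform (- X) x = - qform X x.
Proof. by rewrite !qform_dot mulmxN dotNl. Qed.
Lemma qform0 x : qform 0 x = 0.
Proof. by rewrite qform_dot mulmx0 dot0l. Qed.
Lemma qform_scalar a x : qform a%:M x = a * nsq x.
Proof. by rewrite qform_dot mul_mx_scalar dotZl nsq_dot. Qed.
Lemma qformZr X a x : qform X (a *: x) = a ^+ 2 * qform X x.
Proof. by rewrite !qform_dot -scalemxAl dotZl dotZr mulrA expr2. Qed.
Lemma qform_add X x y : X^T = X ->
  qform X (x + y) = qform X x + 2 * dot (x *m X) y + qform X y.
Proof.
move=> symX; rewrite !qform_dot mulmxDl !dotDl !dotDr.
suff -> : dot (y *m X) x = dot (x *m X) y by ring.
by rewrite [RHS]dotC /dot trmx_mul symX mulmxA.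
Qed.

Lemma nsqN x : nsq (- x) = nsq x.
Proof. by rewrite !nsq_dot dotNl dotNr opprK. Qed.
Lemma nsqZ a x : nsq (a *: x) = a ^+ 2 * nsq x.
Proof. by rewrite !nsq_dot dotZl dotZr mulrA expr2. Qed.
Lemma nsqD x y : nsq (x + y) = nsq x + 2 * dot x y + nsq y.
Proof. by rewrite !nsq_dot dotDl !dotDr (dotC y x); ring. Qed.
Lemma nsq0 : nsq (0 : 'rV[R]_n) = 0.
Proof. by rewrite nsq_dot dot0l. Qed.

Lemma nsqD_le x y : nsq (x + y) <= 2 * nsq x + 2 * nsq y.
Proof.
have := nsq_ge0 (x - y); rewrite !nsqD nsqN dotNr; lra.
Qed.

Lemma coord_le_nsq x i : x 0 i ^+ 2 <= nsq x.
Proof.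
rewrite nsqE (bigD1 i)//= lerDl sumr_ge0// => j _; exact: sqr_ge0.
Qed.

Lemma coord_le_enorm x i : `|x 0 i| <= enorm x.
Proof. by rewrite enorm_sqrt -sqrtr_sqr ler_wsqrtr// coord_le_nsq. Qed.

Lemma mxnorm_le_enorm x : `|x| <= enorm x.
Proof.
rewrite [leLHS]mx_normrE; apply/bigmax_leP; split; first exact: enorm_ge0.
by move=> [i j] _ /=; rewrite (ord1 i) coord_le_enorm.
Qed.

Lemma nsq_eq0 x : nsq x = 0 -> x = 0.
Proof.
move=> x0; apply/rowP => i; rewrite mxE; apply/eqP.
by rewrite -sqrf_eq0 -[_ == 0]/(_) eq_le sqr_ge0 andbT -x0 coord_le_nsq.
Qed.

Lemma nsq_continuous : continuous (nsq : 'rV[R]_n -> R).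
Proof.
have -> : (nsq : 'rV[R]_n -> R) = fun x => \sum_i x 0 i ^+ 2.
  by apply/funext => x; exact: nsqE.
apply: sum_continuous => i x.
by apply: (@continuous_comp _ _ _ (fun x : 'rV[R]_n => x 0 i) (fun a : R => a ^+ 2));
  [exact: coord_continuous|exact: exprn_continuous].
Qed.

Lemma dot_continuous p : continuous (dot p).
Proof.
have -> : dot p = fun x => \sum_i p 0 i * x 0 i by apply/funext => x; exact: dotE.
apply: sum_continuous => i x.
by apply: (@cvgM _ _ (nbhs x)); [exact: cvg_cst|exact: coord_continuous].
Qed.

Lemma qform_continuous X : continuous (qform X).
Proof.
have -> : qform X = fun x => \sum_i (\sum_j x 0 j * X j i) * x 0 i.
  apply/funext => x; rewrite qform_dot dotE; apply: eq_bigr => i _.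
  by rewrite mxE.
apply: sum_continuous => i x; apply: (@cvgM _ _ (nbhs x)); last exact: coord_continuous.
move: x; apply: sum_continuous => j x.
by apply: (@cvgM _ _ (nbhs x)); [exact: coord_continuous|exact: cvg_cst].
Qed.

End Vectors.

(** * Parabolic semijets *)

Section Jets.
Context {R : realType} {n : nat}.
Notation V := 'rV[R]_n.
Notation M := 'M[R]_n.
Implicit Types (v g : V * R -> R) (z : V * R) (p : V) (X : M) (tau : R).

Definition taylor p X tau z0 z : R :=
  tau * (z.2 - z0.2) + dot p (z.1 - z0.1) + 2^-1 * qform X (z.1 - z0.1).

Definition pdist z0 z : R := `|z.2 - z0.2| + nsq (z.1 - z0.1).

Lemma JplusE v z0 p X tau : Jplus v z0 (p, X, tau) <->
  X^T = X /\ forall eps, 0 < eps ->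
    \forall z \near z0, v z <= v z0 + taylor p X tau z0 z + eps * pdist z0 z.
Proof.
split=> -[symX Jv]; split=> // eps /Jv; apply: filterS => z /=;
  by rewrite /taylor /dot /qform /pdist /nsq !addrA.
Qed.

Lemma near_line (P : set (V * R)) z (y : V) (b : R) : (\forall z' \near z, P z') ->
  \forall s \near (0 : R), P (z.1 + s *: y, z.2 + s * b).
Proof.
move=> Pz.
have c1 : (fun s : R => z.1 + s *: y) @ nbhs (0 : R) --> z.1 + 0 *: y.
  apply: (@mx_cvg R n 1 R (nbhs (0 : R)) _ (fun s => z.1 + s *: y)) => i j.
  under eq_fun do rewrite !mxE; rewrite !mxE.
  by apply: cvgD; [exact: cvg_cst|apply: cvgM; [exact: cvg_id|exact: cvg_cst]].
have c2 : (fun s : R => z.2 + s * b) @ nbhs (0 : R) --> z.2 + 0 * b.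
  by apply: cvgD; [exact: cvg_cst|apply: cvgM; [exact: cvg_id|exact: cvg_cst]].
rewrite scale0r addr0 in c1; rewrite mul0r addr0 in c2.
have cv := cvg_pair c1 c2.
have {}Pz : nbhs (z.1, z.2) P by rewrite -surjective_pairing.
exact: cv.
Qed.

(** With s = - r a and r > 0 small, the linear term - r a ^ 2 dominates. *)
Lemma nbhs_linear_eq0 (a b : R) :
  (\forall s \near (0 : R), 0 <= s * a + s ^+ 2 * b) -> a = 0.
Proof.
move=> H; apply/eqP; apply: contrapT => /negP a0.
have cv c : r * c @[r --> (0 : R)] --> (0 : R).
  by rewrite -[X in _ --> X](mul0r c); apply: cvgM; [exact: cvg_id|exact: cvg_cst].
have H1 : \forall r \near (0 : R), r * b < 1 by apply: cvgr_lt (cv b) _ ltr01.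
have H2 := cv (- a) _ H.
near (0 : R)^'+ => r.
have r0 : 0 < r by [].
have : 0 <= (r * - a) * a + (r * - a) ^+ 2 * b.
  by near: r; apply: cvg_within; exact: H2.
have rb : r * b < 1 by near: r; apply: cvg_within; exact: H1.
have -> : (r * - a) * a + (r * - a) ^+ 2 * b = (r * a ^+ 2) * (r * b - 1) by ring.
by rewrite leNgt pmulr_rlt0 ?subr_lt0 ?rb// mulr_gt0// exprn_even_gt0.
Unshelve. all: by end_near. Qed.

Lemma nbhs_abs_eq0 (a C : R) :
  (forall eps, 0 < eps ->
    \forall s \near (0 : R), 0 <= s * a + C * s ^+ 2 + eps * `|s|) -> a = 0.
Proof.
move=> H; apply/eqP; apply: contrapT => /negP a0.
have cv c : r * c @[r --> (0 : R)] --> (0 : R).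
  by rewrite -[X in _ --> X](mul0r c); apply: cvgM; [exact: cvg_id|exact: cvg_cst].
have a20 : 0 < `|a| / 2 by rewrite divr_gt0// normr_gt0.
have H1 : \forall r \near (0 : R), r * (a ^+ 2 * C) < (`|a| * (`|a| / 2)).
  by apply: cvgr_lt (cv _) _ _; rewrite mulr_gt0// normr_gt0.
have H2 := cv (- a) _ (H _ a20).
near (0 : R)^'+ => r.
have r0 : 0 < r by [].
have : 0 <= (r * - a) * a + C * (r * - a) ^+ 2 + `|a| / 2 * `|r * - a|.
  by near: r; apply: cvg_within; exact: H2.
have rb : r * (a ^+ 2 * C) < (`|a| * (`|a| / 2)).
  by near: r; apply: cvg_within; exact: H1.
rewrite normrM normrN (gtr0_norm r0).
have -> : (r * - a) * a + C * (r * - a) ^+ 2 + `|a| / 2 * (r * `|a|) =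
  r * (r * (a ^+ 2 * C) - `|a| * (`|a| / 2)).
  have -> : a ^+ 2 = `|a| ^+ 2 by rewrite real_normK// num_real.
  have : a * a = `|a| * `|a| by rewrite -!expr2 real_normK// num_real.
  move: `|a| => d ad; have -> : r * - a * a = - r * (d * d) by rewrite -ad; ring.
  have -> : (r * - a) ^+ 2 = r ^+ 2 * (a * a) by ring.
  by rewrite ad; field.
by rewrite leNgt pmulr_rlt0 ?subr_lt0 ?rb.
Unshelve. all: by end_near. Qed.

Lemma Jplus_le_near v g z0 j : v z0 = g z0 -> (\forall z \near z0, v z <= g z) ->
  Jplus g z0 j -> Jplus v z0 j.
Proof.
move: j => [[p X] tau] e le [symX Jg]; split=> // eps /Jg H.
by apply: filterS2 le H => z le; rewrite /= e; exact: le_trans.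
Qed.

Lemma Jplus_local_max v g z0 j :
  (\forall z \near z0, v z <= v z0 + (g z - g z0)) ->
  Jplus g z0 j -> Jplus v z0 j.
Proof.
move: j => [[p X] tau] le /JplusE[symX Jg]; apply/JplusE; split=> // eps /Jg H.
by apply: filterS2 le H => z le; move: le; lra.
Qed.

Lemma JplusD v g z0 p X tau p' X' tau' : Jplus v z0 (p, X, tau) ->
  Jplus g z0 (p', X', tau') -> Jplus (v \+ g) z0 (p + p', X + X', tau + tau').
Proof.
move=> /JplusE[symX Jv] /JplusE[symX' Jg]; apply/JplusE; split.
  by rewrite linearD /= symX symX'.
move=> eps e0; have e20 : 0 < eps / 2 by rewrite divr_gt0.
apply: filterS2 (Jv _ e20) (Jg _ e20) => z.
rewrite /taylor /= dotDl qformD; lra.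
Qed.

(** A remainder quadratic in time is a small multiple of the time increment, so
the little-o of the jets absorbs it. *)
Lemma Jplus_taylor v z0 p X tau C : X^T = X ->
  (\forall z \near z0,
     v z <= v z0 + taylor p X tau z0 z + C * (z.2 - z0.2) ^+ 2) ->
  Jplus v z0 (p, X, tau).
Proof.
move=> symX H; apply/JplusE; split=> // eps e0.
have small : \forall z \near z0, C * `|z.2 - z0.2| <= eps.
  have cv : (fun z : V * R => C * `|z.2 - z0.2|) @ z0 --> (0 : R).
    rewrite -[X in _ --> X](mulr0 C) -[X in C * X](@normr0 _ R).
    rewrite -[X in `|X|](subrr z0.2).
    apply: cvgM; first exact: cvg_cst.
    by apply: cvg_norm; apply: cvgB; [exact: cvg_snd|exact: cvg_cst].
  exact: cvgr_le cv _ e0.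
apply: filterS2 H small => z H small; apply: (le_trans H); rewrite lerD2l.
rewrite -[leLHS]/(_) -real_normK ?num_real// expr2 mulrA /pdist mulrDr.
apply: ler_wpDr; first by rewrite mulr_ge0 ?nsq_ge0// ltW.
by rewrite ler_wpM2r.
Qed.

(** Along every line through z0 the difference of the two expansions is
nonnegative up to the error terms, so its linear part vanishes and its
quadratic part in space is nonnegative. *)
Lemma Jplus_touching v z0 p X tau p0 X0 tau0 C :
  Jplus v z0 (p, X, tau) ->
  (\forall z \near z0,
     v z0 + taylor p0 X0 tau0 z0 z - C * (z.2 - z0.2) ^+ 2 <= v z) ->
  [/\ p = p0, tau = tau0 & forall y, qform X0 y <= qform X y].
Proof.
move=> /JplusE[symX J] low.
have tl w Y a (y : V) (b s : R) : taylor w Y a z0 (z0.1 + s *: y, z0.2 + s * b) =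
    a * (s * b) + s * dot w y + 2^-1 * (s ^+ 2 * qform Y y).
  rewrite /taylor /=.
  have -> : z0.1 + s *: y - z0.1 = s *: y by rewrite addrAC subrr add0r.
  have -> : z0.2 + s * b - z0.2 = s * b by rewrite addrAC subrr add0r.
  by rewrite dotZr qformZr.
have dl (y : V) (b s : R) : pdist z0 (z0.1 + s *: y, z0.2 + s * b) =
    `|s * b| + s ^+ 2 * nsq y.
  rewrite /pdist /=.
  have -> : z0.1 + s *: y - z0.1 = s *: y by rewrite addrAC subrr add0r.
  have -> : z0.2 + s * b - z0.2 = s * b by rewrite addrAC subrr add0r.
  by rewrite nsqZ.
have cmp y b eps : 0 < eps -> \forall s \near (0 : R),
    0 <= (tau - tau0) * (s * b) + s * (dot p y - dot p0 y) +
      2^-1 * (s ^+ 2 * (qform X y - qform X0 y)) +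
      C * (s * b) ^+ 2 + eps * (`|s * b| + s ^+ 2 * nsq y).
  move=> e0; have H1 := near_line y b low; have H2 := near_line y b (J _ e0).
  apply: filterS2 H1 H2 => s /=.

  rewrite !tl dl /=.
  have -> : z0.2 + s * b - z0.2 = s * b by rewrite addrAC subrr add0r.
  lra.
have eqtau : tau = tau0.
  apply/eqP; rewrite -subr_eq0; apply/eqP/(@nbhs_abs_eq0 _ C) => eps e0.
  apply: (@filterS _ (nbhs (0 : R)) _ _ _ _ (cmp 0 1 eps e0)) => s.
  rewrite !dot0r nsq0 !qform_dot !dot0r.
  rewrite !mulr1; lra.
have eqp y : dot p y - dot p0 y = 0.
  apply: (@nbhs_linear_eq0 _ (2^-1 * (qform X y - qform X0 y) + nsq y)).
  apply: (@filterS _ (nbhs (0 : R)) _ _ _ _ (cmp y 0 1 ltr01)) => s; rewrite !mulr0 normr0; lra.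
split=> //.
  apply/rowP => i; apply/eqP; rewrite -subr_eq0; apply/eqP.
  by have := eqp (delta_mx 0 i); rewrite /dot trmx_delta -!colE !mxE.
move=> y; rewrite leNgt; apply/negP => lt.
pose eps := (qform X0 y - qform X y) / (4 * (nsq y + 1)).
have n0 : 0 < nsq y + 1 by rewrite ltr_wpDl ?nsq_ge0.
have e0 : 0 < eps by rewrite divr_gt0 ?subr_gt0// mulr_gt0.
have epsE : eps * (4 * (nsq y + 1)) = qform X0 y - qform X y.
  by rewrite /eps mulfVK// gt_eqF// mulr_gt0.
have H := cmp y 0 eps e0.
near (0 : R)^'+ => s.
have s0 : 0 < s by [].
have : 0 <= (tau - tau0) * (s * 0) + s * (dot p y - dot p0 y) +
      2^-1 * (s ^+ 2 * (qform X y - qform X0 y)) +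
      C * (s * 0) ^+ 2 + eps * (`|s * 0| + s ^+ 2 * nsq y).
  by near: s; apply: cvg_within; exact: H.
rewrite eqp !mulr0 normr0 expr0n /= !mulr0 !add0r addr0.
have -> : 2^-1 * (s ^+ 2 * (qform X y - qform X0 y)) + eps * (s ^+ 2 * nsq y) =
  s ^+ 2 * (eps * nsq y - 2^-1 * (eps * (4 * (nsq y + 1)))).
  by rewrite epsE; ring.
rewrite leNgt pmulr_rlt0 ?exprn_gt0//.
have := mulr_ge0 (ltW e0) (nsq_ge0 y); lra.
Unshelve. all: by end_near. Qed.

End Jets.

(** * The Hamiltonian and its envelopes *)

Section Hamiltonian.
Context {R : realType} {n : nat}.
Notation V := 'rV[R]_n.
Notation M := 'M[R]_n.
Implicit Types (p : V) (X : M).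

(** The Hamiltonian with its trace expanded: a formula whose continuity away
from p = 0 can be read off. *)
Definition Hval (a : V * M) : R :=
  - (\tr a.2 - (nsq a.1)^-1 * qform a.2 a.1) - enorm a.1.

Lemma tr_sigma p X : \tr (sigma p *m X) = \tr X - (nsq p)^-1 * qform X p.
Proof.
rewrite /sigma mulmxBl mul1mx raddfB /= -scalemxAl mxtraceZ; congr (_ - _ * _).
by rewrite -mulmxA mxtrace_mulC /mxtrace big_ord1.
Qed.

Lemma H_Hval a : @H R n a = Hval a.
Proof. by rewrite /H tr_sigma. Qed.

Lemma enorm_continuous : continuous (@enorm R n).
Proof.
move=> x; have -> : (@enorm R n) = fun y => Num.sqrt (nsq y).
  by apply/funext => y; exact: enorm_sqrt.
apply: (@continuous_comp _ _ _ (nsq : V -> R) Num.sqrt); first exact: nsq_continuous.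
exact: sqrt_continuous.
Qed.

Lemma mxtrace_continuous : continuous (@mxtrace R n).
Proof.
by apply: (@sum_continuous R M _ _ (fun i (X : M) => X i i)) => i; exact: coord_continuous.
Qed.

Lemma Hval_continuous a : a.1 != 0 -> {for a, continuous Hval}.
Proof.
move=> p0.
have c1 : (fun b : V * M => b.1) @ a --> a.1 by exact: cvg_fst.
have c2 : (fun b : V * M => b.2) @ a --> a.2 by exact: cvg_snd.
have q : (fun b : V * M => qform b.2 b.1) @ a --> qform a.2 a.1.
  have E b : qform b.2 b.1 = \sum_i (\sum_j b.1 0 j * b.2 j i) * b.1 0 i :> R.
    by rewrite qform_dot dotE; apply: eq_bigr => i _; rewrite mxE.
  rewrite E; under eq_fun do rewrite E.
  have k1 i : continuous (fun b : V * M => b.1 0 i).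
    move=> b; apply: (@continuous_comp _ _ _ (fun b : V * M => b.1) (fun q : V => q 0 i)).
      exact: cvg_fst.
    exact: coord_continuous.
  have k2 i j : continuous (fun b : V * M => b.2 i j).
    move=> b; apply: (@continuous_comp _ _ _ (fun b : V * M => b.2) (fun q : M => q i j)).
      exact: cvg_snd.
    exact: coord_continuous.
  move: (a); apply: sum_continuous => i b.
  apply: (@cvgM _ _ (nbhs b)); last exact: k1.
  by move: b; apply: sum_continuous => j b; apply: (@cvgM _ _ (nbhs b)); [exact: k1|exact: k2].
have nz : nsq a.1 != 0 by apply: contra p0 => /eqP/nsq_eq0 ->.
apply: cvgB; last by apply: cvg_comp c1 _; exact: enorm_continuous.
apply: cvgN; apply: cvgB; first by apply: cvg_comp c2 _; exact: mxtrace_continuous.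
apply: cvgM q; apply: cvgV => //.
by apply: cvg_comp c1 _; exact: nsq_continuous.
Qed.

Definition Hconst : R := n%:R + (n * n)%:R.

Lemma Hconst_ge0 : 0 <= Hconst.
Proof. by rewrite addr_ge0. Qed.

Lemma mx_entry_le m k (X : 'M[R]_(m, k)) i j : `|X i j| <= `|X|.
Proof.
rewrite [leRHS]mx_normrE.
by have := @le_bigmax _ R _ 0 (fun ij : 'I_m * 'I_k => `|X ij.1 ij.2|) (i, j).
Qed.

Lemma qform_bound X p : `|qform X p| <= (n * n)%:R * `|X| * nsq p.
Proof.
have -> : qform X p = \sum_i (\sum_j p 0 j * X j i) * p 0 i.
  by rewrite qform_dot dotE; apply: eq_bigr => i _; rewrite mxE.
apply: (le_trans (ler_norm_sum _ _ _)).
apply: (@le_trans _ _ (\sum_(i < n) (n%:R * `|X| * nsq p))); last first.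
  by rewrite sumr_const card_ord -[leLHS]mulr_natl natrM !mulrA.
apply: ler_sum => i _; rewrite mulr_suml; apply: (le_trans (ler_norm_sum _ _ _)).
apply: (@le_trans _ _ (\sum_(j < n) (`|X| * nsq p))); last first.
  by rewrite sumr_const card_ord -[leLHS]mulr_natl !mulrA.
apply: ler_sum => j _; rewrite mulrAC mulrC normrM ler_pM ?mx_entry_le//.
have := coord_le_nsq p i; have := coord_le_nsq p j.
rewrite normrM -[p 0 j ^+ 2]real_normK ?num_real// -[p 0 i ^+ 2]real_normK ?num_real//.
have := sqr_ge0 (`|p 0 i| - `|p 0 j|); rewrite sqrrB.
move: `|p 0 i| `|p 0 j| => b c; lra.
Qed.

(** The projection sigma p is bounded, so the trace term is controlled by X
alone: this keeps the Hamiltonian locally bounded near the singularity p =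
0, and its envelopes finite there. *)
Lemma Hval_bound p X : `|Hval (p, X) + enorm p| <= Hconst * `|X|.
Proof.
rewrite /Hval /= subrK normrN /Hconst mulrDl.
apply: (le_trans (ler_normB _ _)); apply: lerD.
  apply: (le_trans (ler_norm_sum _ _ _)).
  rewrite mulr_natl; have <- : \sum_(i < n) `|X| = `|X| *+ n.
    by rewrite sumr_const card_ord.
  by apply: ler_sum => i _; exact: mx_entry_le.
have [p0|p0] := eqVneq (nsq p) 0.
  by rewrite p0 invr0 mul0r normr0 mulr_ge0.
have pp : 0 < nsq p by rewrite lt_def p0 nsq_ge0.
rewrite normrM ger0_norm ?invr_ge0 ?nsq_ge0// mulrC ler_pdivrMr//.
exact: qform_bound.
Qed.

(** In positive dimension 0 is a limit of nonzero vectors, so that the envelopes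
at p = 0 are taken along a proper filter. *)
Lemma Hdom_closure p X : (0 < n)%N -> X^T = X -> closure (@Hdom R n) (p, X).
Proof.
move=> n0 symX; have [->|p0] := eqVneq p 0; last exact: subset_closure.
move=> B [[P Q] /= [P0 QX] PQ].
have cv : const_mx s @[s --> (0 : R)^'] --> (0 : V).
  apply: (@mx_cvg R n 1 R ((0 : R)^') _ (fun s => const_mx s)) => i j.
  by under eq_fun do rewrite mxE; rewrite mxE; apply: cvg_within_filter; exact: cvg_id.
have [s [/= s0 Ps]] := filter_ex (filterI (nbhs_dnbhs_neq 0) (cv _ P0)).
exists (const_mx s, X); split; last by apply: PQ; split=> /=; [exact: Ps|exact: nbhs_singleton QX].
split=> //=; apply/negP => /eqP/rowP/(_ (Ordinal n0)); rewrite !mxE => /eqP.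
by apply/negP.
Qed.

Hypothesis n0 : (0 < n)%N.

Let Hbnd_cont C a : {for a, continuous (fun b : V * M => C * `|b.2| + enorm b.1)}.
Proof.
apply: cvgD; last first.
  apply: (@continuous_comp _ _ _ (fun b : V * M => b.1) (@enorm R n)).
    exact: cvg_fst.
  exact: enorm_continuous.
by apply: cvgM; [exact: cvg_cst|apply: cvg_norm; exact: cvg_snd].
Qed.

Lemma H_bounded_near (a : V * M) : bounded_near (@H R n) (within (@Hdom R n) (nbhs a)).
Proof.
apply: (@bounded_near_le _ _ _ _ (fun b : V * M => Hconst * `|b.2| + enorm b.1)).
  exact: Hbnd_cont.
near=> b; rewrite H_Hval; have := Hval_bound b.1 b.2; rewrite -surjective_pairing.
rewrite !ler_norml => /andP[h1 h2]; have := enorm_ge0 b.1.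
by move=> e0; apply/andP; split; lra.
Unshelve. all: by end_near. Qed.

Lemma oppH_bounded_near (a : V * M) :
  bounded_near (\- @H R n) (within (@Hdom R n) (nbhs a)).
Proof.
have := H_bounded_near a; rewrite /bounded_near.
by apply: filterS => C; apply: filterS => b /=; rewrite normrN.
Qed.

Lemma Hlow_ge p X : X^T = X -> - Hconst * `|X| - enorm p <= Hlow (p, X).
Proof.
move=> symX; rewrite /Hlow lsc_envE lerNr.
have -> : - (- Hconst * `|X| - enorm p) = Hconst * `|X| + enorm p by ring.
apply: (@usc_env_le_continuous _ _ _ _ (fun b : V * M => Hconst * `|b.2| + enorm b.1));
  [exact: Hdom_closure|exact: oppH_bounded_near|exact: Hbnd_cont|].
near=> b; rewrite /= H_Hval; have := Hval_bound b.1 b.2; rewrite -surjective_pairing.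
rewrite ler_norml => /andP[h1 h2]; lra.
Unshelve. all: by end_near. Qed.

Lemma Hup_le p X : X^T = X -> Hup (p, X) <= Hconst * `|X|.
Proof.
move=> symX; rewrite /Hup.
apply: (@usc_env_le_continuous _ _ _ _ (fun b : V * M => Hconst * `|b.2|)).
- exact: Hdom_closure.
- exact: H_bounded_near.
- by apply: cvgM; [exact: cvg_cst|apply: cvg_norm; exact: cvg_snd].
near=> b; rewrite /= H_Hval; have := Hval_bound b.1 b.2; rewrite -surjective_pairing.
rewrite ler_norml => /andP[h1 h2]; have := enorm_ge0 b.1; lra.
Unshelve. all: by end_near. Qed.

Lemma Hlow_le_Hup p X : X^T = X -> Hlow (p, X) <= Hup (p, X).
Proof.
move=> symX; rewrite /Hlow /Hup lsc_envE; apply/ler_addgt0Pr => e e0.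
have cl : closure (@Hdom R n) (p, X) by exact: Hdom_closure.
rewrite leNgt; apply/negP => lt.
have PF := within_closure_proper cl.
have h1 : \forall b \near within (@Hdom R n) (nbhs (p, X)),
    @H R n b < usc_env (@Hdom R n) (@H R n) (p, X) + e / 2.
  by apply: usc_env_lt => //; [exact: H_bounded_near|lra].
have h2 : \forall b \near within (@Hdom R n) (nbhs (p, X)),
    (\- @H R n) b < usc_env (@Hdom R n) (\- @H R n) (p, X) + e / 2.
  by apply: usc_env_lt => //; [exact: oppH_bounded_near|lra].
by have [b [/= ]] := filter_ex (filterI h1 h2); lra.
Qed.

Lemma Hlow_ge_Hval p X : X^T = X -> p != 0 -> Hval (p, X) <= Hlow (p, X).
Proof.
move=> symX p0; rewrite /Hlow lsc_envE lerNr.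
apply: (@usc_env_le_continuous _ _ _ _ (\- Hval)).
- exact: Hdom_closure.
- exact: oppH_bounded_near.
- by apply: cvgN; exact: Hval_continuous.
by near=> b; rewrite /= H_Hval.
Unshelve. all: by end_near. Qed.

(** Since sigma p is an orthogonal projection, the trace of sigma p *m X is that
of sigma p *m X *m sigma p, whose diagonal entries are values of the
quadratic form of X. *)
Lemma tr_sigma_ge0 p X : (forall y, 0 <= qform X y) -> p != 0 ->
  0 <= \tr (sigma p *m X).
Proof.
move=> X0 p0.
have nz : nsq p != 0 by apply: contra p0 => /eqP/nsq_eq0 ->.
have sT : (sigma p)^T = sigma p.
  by rewrite /sigma linearB /= linearZ /= trmx_mul trmxK trmx1.
have ss : sigma p *m sigma p = sigma p.
  rewrite {1}/sigma mulmxBl mul1mx -scalemxAl.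
  suff -> : p^T *m p *m sigma p = 0 by rewrite scaler0 subr0.
  rewrite /sigma mulmxBr mulmx1 -scalemxAr mulmxA -(mulmxA p^T p p^T).
  rewrite (_ : p *m p^T = (nsq p)%:M); last first.
    by rewrite [LHS]mx11_scalar nsq_dot.
  rewrite mul_mx_scalar -scalemxAl scalerA.
  by rewrite -[enorm p ^+ 2]/(nsq p) mulVf// scale1r subrr.
rewrite -ss -mulmxA mxtrace_mulC; apply: sumr_ge0 => i _.
suff -> : (sigma p *m X *m sigma p) i i = qform X (row i (sigma p)) by exact: X0.
rewrite /qform -row_mul mxE [RHS]mxE; apply: eq_bigr => j _.
by rewrite [row i (_ *m _) _ _]mxE [(row i _)^T _ _]mxE [row i _ _ _]mxE -{2}sT [_^T _ _]mxE.
Qed.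

(** Degenerate ellipticity: translation by Y - X carries neighborhoods of (p, X)
to neighborhoods of (p, Y) and can only decrease the Hamiltonian. *)
Lemma Hlow_elliptic p X Y : X^T = X -> Y^T = Y ->
  (forall y, qform X y <= qform Y y) -> Hlow (p, Y) <= Hlow (p, X).
Proof.
move=> symX symY XY; rewrite /Hlow !lsc_envE lerN2.
rewrite leNgt; apply/negP => lt.
have clX : closure (@Hdom R n) (p, X) by exact: Hdom_closure.
have clY : closure (@Hdom R n) (p, Y) by exact: Hdom_closure.
have [c /andP[c1 c2]] : exists c, usc_env (@Hdom R n) (\- @H R n) (p, Y) < c <
    usc_env (@Hdom R n) (\- @H R n) (p, X).
  exists ((usc_env (@Hdom R n) (\- @H R n) (p, Y) +
    usc_env (@Hdom R n) (\- @H R n) (p, X)) / 2).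
  by rewrite !midf_lt.
have /= := usc_env_lt clY (@oppH_bounded_near _) c1.
rewrite near_withinE => nearY.
move: c2; rewrite ltNge => /negP; apply.
apply: usc_env_le => //; first exact: oppH_bounded_near.
rewrite near_withinE.
have sh : (fun b : V * M => (b.1, b.2 + (Y - X))) @ (p, X) --> (p, Y).
  have c2 : (fun b : V * M => b.2 + (Y - X)) @ (p, X) --> X + (Y - X).
    by apply: cvgD; [exact: cvg_snd|exact: cvg_cst].
  rewrite [X + _]addrC subrK in c2.
  have c3 : (fun b : V * M => b.1) @ (p, X) --> p by exact: cvg_fst.
  exact: (cvg_pair c3 c2).
have nY := sh _ nearY.
apply: (@filterS _ (nbhs (p, X)) _ _ _ _ nY) => -[q Z] /= hq [/= q0 symZ].
apply: ltW; apply: le_lt_trans (hq _); last first.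
  by split=> //=; rewrite !linearD /= linearN /= symZ symX symY.
rewrite lerN2 /H /= lerD2r lerN2 mulmxDr mxtraceD lerDl.
by apply: tr_sigma_ge0 => // y; rewrite qformD qformN subr_ge0.
Qed.

End Hamiltonian.

(** * Comparison with classical barriers *)

(* Abstracts the envelopes and drops the context before calling lra, which
would otherwise try to identify different envelopes by unfolding them. *)
Ltac envelope_lra :=
  repeat match goal with
  | |- context [usc_env ?D ?u ?z] =>
      let e := fresh "e" in set e := (usc_env D u z); clearbody e
  | |- context [lsc_env ?D ?u ?z] =>
      let e := fresh "e" in set e := (lsc_env D u z); clearbody e
  | |- context [Hlow ?a] =>
      let e := fresh "e" in set e := (Hlow a); clearbody e
  | |- context [Hup ?a] =>
      let e := fresh "e" in set e := (Hup a); clearbody e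
  end;
  repeat match goal with
  | H : is_true (Order.le _ _) |- _ => clear H
  | H : is_true (Order.lt _ _) |- _ => clear H
  | H : _ = _ |- _ => clear H
  end; lra.

Section Spacetime.
Context {R : realType} {n : nat}.
Notation V := 'rV[R]_n.
Notation M := 'M[R]_n.
Notation ST := (@spacetime R n).
Implicit Types (u v w phi : V * R -> R) (f g : V -> R) (z : V * R).

Definition uenv u : V * R -> R := usc_env ST u.

Lemma spacetime_closure z : ST z -> closure ST z.
Proof. exact: subset_closure. Qed.

Lemma closure_spacetime : closure ST = ST.
Proof.
apply/esym/closure_id; rewrite (_ : ST = (fun z : V * R => z.2) @^-1` [set t | 0 <= t])//.
by apply: closed_comp => [z _|]; [exact: cvg_snd|exact: closed_ge].
Qed.

Lemma near_positive_time z : 0 < z.2 -> \forall z' \near z, 0 < z'.2.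
Proof.
move=> t0; have cv : (fun z' : V * R => z'.2) @ z --> z.2 by exact: cvg_snd.
exact: (cvgr_gt _ cv).
Qed.

Lemma uenv_near u z c : locally_bounded u -> ST z -> uenv u z < c ->
  \forall y \near within ST (nbhs z), uenv u y < c.
Proof.
move=> lb Sz; have := @usc_env_near _ _ ST u z c; rewrite closure_spacetime.
by apply=> // y; exact: lb.
Qed.

Lemma uenv_ub u z : locally_bounded u -> ST z -> u z <= uenv u z.
Proof. by move=> lb Sz; apply: usc_env_ub => //; exact: lb. Qed.

Lemma uenv_le_near u v z : locally_bounded u -> locally_bounded v -> ST z ->
  (\forall y \near within ST (nbhs z), u y <= v y) -> uenv u z <= uenv v z.
Proof.
move=> lu lv Sz uv; apply: usc_env_mono => //; first exact: spacetime_closure.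
- exact: lu.
- exact: lv.
Qed.

Lemma uenv_le_continuous u phi z : locally_bounded u -> ST z ->
  {for z, continuous phi} ->
  (\forall y \near within ST (nbhs z), u y <= phi y) -> uenv u z <= phi z.
Proof.
move=> lu Sz c le; apply: usc_env_le_continuous => //; last exact: lu.
exact: spacetime_closure.
Qed.

Lemma locally_bounded_le u phi : continuous phi ->
  (forall z, ST z -> `|u z| <= phi z) -> locally_bounded u.
Proof.
move=> c le z Sz; apply: (@bounded_near_le _ _ _ _ phi); first exact: c.
by rewrite near_withinE; near=> y; exact: le.
Unshelve. all: by end_near. Qed.

Lemma uenv_sub_max u phi (K : set (V * R)) : compact K -> K !=set0 ->
  K `<=` ST -> locally_bounded u -> continuous phi ->
  exists2 z, K z & forall y, K y -> uenv u y - phi y <= uenv u z - phi z.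
Proof.
move=> cK K0 KST lb cphi; apply: (usc_compact_max (g := fun z => uenv u z - phi z)) => //.
move=> z c Kz ltc; set d := (c - (uenv u z - phi z)) / 2.
have d0 : 0 < d by rewrite divr_gt0// subr_gt0.
have h1 : \forall y \near within ST (nbhs z), uenv u y < uenv u z + d.
  by apply: uenv_near; [|exact: KST|rewrite ltrDl].
have h2 : \forall y \near z, phi z - d < phi y.
  by apply: (cvgr_gt _ (cphi z)); rewrite ltrBlDr ltrDl.
rewrite near_withinE in h1; apply: filterS2 h1 h2 => y h1 h2 Ky; have := h1 (KST _ Ky).
have dE : d * 2 = c - (uenv u z - phi z) by rewrite /d divfK.
by move: h2 dE; move: (uenv u y) (uenv u z) (phi y) (phi z) d {h1 d0} => a b e k d; envelope_lra.
Qed.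

Definition penalty (A t1 : R) z : R := A * Num.max 0 (z.2 - t1) ^+ 2.

Lemma maxr0E (x : R) : Num.max 0 x = (x + `|x|) / 2.
Proof.
by case: (lerP 0 x) => x0; [rewrite ger0_norm//|rewrite ltr0_norm// subrr mul0r];
  field.
Qed.

Lemma max0_continuous : continuous (fun x : R => Num.max 0 x).
Proof.
have -> : (fun x : R => Num.max 0 x) = (fun x => (x + `|x|) / 2).
  by apply/funext => x; exact: maxr0E.
move=> x; apply: cvgM; last exact: cvg_cst.
by apply: cvgD; [exact: cvg_id|apply: cvg_norm; exact: cvg_id].
Qed.

Lemma penalty_continuous A t1 : continuous (penalty A t1).
Proof.
move=> z; apply: cvgM; first exact: cvg_cst.
have c : (fun z : V * R => z.2 - t1) @ z --> z.2 - t1.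
  by apply: cvgB; [exact: cvg_snd|exact: cvg_cst].
have c' := cvg_comp _ _ c (@max0_continuous (z.2 - t1)).
by rewrite expr2; under eq_fun do rewrite expr2; apply: (@cvgM _ _ (nbhs z)).
Qed.

Lemma penalty_ge0 A t1 z : 0 <= A -> 0 <= penalty A t1 z.
Proof. by move=> A0; rewrite mulr_ge0// sqr_ge0. Qed.

Lemma penalty_jet A t1 z : 0 <= A ->
  Jplus (penalty A t1) z (0, 0, 2 * A * Num.max 0 (z.2 - t1)).
Proof.
move=> A0; apply: (@Jplus_taylor _ _ _ _ _ _ _ A); first by rewrite trmx0.
near=> y; rewrite /taylor dot0l qform0 /penalty.
set a := z.2 - t1; have -> : y.2 - t1 = a + (y.2 - z.2) by rewrite /a; ring.
set h := y.2 - z.2.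
rewrite -subr_ge0.
have -> : A * Num.max 0 a ^+ 2 + (2 * A * Num.max 0 a * h + 0 + 2^-1 * 0) + A * h ^+ 2
   - A * Num.max 0 (a + h) ^+ 2 =
   A * (Num.max 0 a ^+ 2 + 2 * Num.max 0 a * h + h ^+ 2 - Num.max 0 (a + h) ^+ 2) by ring.
apply: mulr_ge0 => //; case: (lerP 0 a) => a0; case: (lerP 0 (a + h)) => ah0.
- by have -> : a ^+ 2 + 2 * a * h + h ^+ 2 - (a + h) ^+ 2 = 0 by ring.
- have -> : a ^+ 2 + 2 * a * h + h ^+ 2 - 0 ^+ 2 = (a + h) ^+ 2 by ring.
  exact: sqr_ge0.
- nra.
- nra.
Unshelve. all: by end_near. Qed.

(** Only the barrier is used as a test function, so no doubling of variables is
needed. The penalty keeps the maximum of the difference away from the final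
time, and its time derivative has a harmless sign. *)
Lemma comparison f g v phi (K : set V) (T : R) :
  subsolution f g v -> compact K -> continuous phi ->
  (forall x t, ~ K x -> 0 <= t <= T -> uenv v (x, t) <= phi (x, t)) ->
  (forall x, g x <= phi (x, 0)) ->
  (forall x t, K x -> 0 < t < T -> phi (x, t) < uenv v (x, t) ->
    exists p X tau, Jplus phi (x, t) (p, X, tau) /\
      usc_env setT f x < tau + Hlow (p, X)) ->
  forall x t, 0 <= t < T -> uenv v (x, t) <= phi (x, t).
Proof.
move=> [lbv v0 subv] cK cphi out init strict x1 t1 /andP[t10 t1T].
rewrite leNgt; apply/negP => lt.
have Kx1 : K x1.
  apply: contrapT => nK; have := out x1 t1 nK; rewrite t10 ltW//= => /(_ isT).
  by rewrite leNgt lt.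
pose Q := K `*` [set t : R | 0 <= t <= T].
have cQ : compact Q.
  apply: compact_setX => //.
  rewrite (_ : [set t | _] = `[0, T]%classic); first exact: segment_compact.
  by apply/seteqP; split=> t /=; rewrite in_itv.
have QST : Q `<=` ST by move=> z [_ /andP[]].
have Qz1 : Q (x1, t1) by split=> //=; rewrite t10 ltW.
have [z0 Qz0 max0] := uenv_sub_max cQ (ex_intro _ _ Qz1) QST lbv cphi.
pose B := uenv v z0 - phi z0.
have leB y : Q y -> uenv v y - phi y <= B by exact: max0.
have B0 : 0 < B.
  by apply: lt_le_trans (max0 _ Qz1); rewrite subr_gt0.
(* With this factor the penalty at the final time equals the maximum B, so that
the penalised maximum is attained before. *)
pose A := B / (T - t1) ^+ 2.
have Tt : 0 < T - t1 by rewrite subr_gt0.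
have A0 : 0 < A by rewrite divr_gt0// exprn_gt0.
have AE : A * (T - t1) ^+ 2 = B by rewrite /A mulfVK// gt_eqF// exprn_gt0.
have cpsi : continuous (phi \+ penalty A t1).
  by move=> z; apply: cvgD; [exact: cphi|exact: penalty_continuous].
have [[x t] [/= Kx /andP[t0 tT]] max1] :=
  uenv_sub_max cQ (ex_intro _ _ Qz1) QST lbv cpsi.
have pos : 0 < uenv v (x, t) - (phi (x, t) + penalty A t1 (x, t)).
  apply: lt_le_trans (max1 _ Qz1) => /=.
  by rewrite /penalty /= subrr maxxx expr0n mulr0 addr0 subr_gt0.
have pen0 := penalty_ge0 t1 (x, t) (ltW A0).
have tT' : t < T.
  rewrite lt_neqAle tT andbT; apply/eqP => tE.
  have penT : penalty A t1 (x, t) = B.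
    by rewrite /penalty /= tE max_r ?AE//; exact: ltW.
  have Qxt : Q (x, t) by split=> //=; rewrite t0 tT.
  move: pos (leB _ Qxt); rewrite penT; move: (uenv v (x, t)) (phi (x, t)) (B) => a b c.
  by envelope_lra.
have t0' : 0 < t.
  rewrite lt_neqAle t0 andbT; apply/eqP => tE.
  have := le_trans (v0 x) (init x); rewrite -/(uenv v (x, 0)) tE => le.
  by move: pos pen0; move: (penalty A t1 _) => pen; move: le; rewrite /uenv; envelope_lra.
have ltv : phi (x, t) < uenv v (x, t).
  by move: pos pen0; move: (penalty A t1 _) => pen; rewrite /uenv; envelope_lra.
have t0T : 0 < t < T by rewrite t0' tT'.
have [p [X [tau [J slt]]]] := strict x t Kx t0T ltv.
have Jv : Jplus (uenv v) (x, t)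
    (p + 0, X + 0, tau + 2 * A * Num.max 0 ((x, t).2 - t1)).
  apply: Jplus_local_max (JplusD J (penalty_jet t1 (x, t) (ltW A0))).
  have n1 : \forall z \near (x, t), z.2 < T.
    have cv : (fun z' : V * R => z'.2) @ (x, t) --> t by exact: cvg_snd.
    exact: (cvgr_lt _ cv).
  have n2 := @near_positive_time (x, t) t0'.
  apply: filterS2 n1 n2 => -[y s] /= sT s0.
  have [Ky|nKy] := pselect (K y).
    have := max1 (y, s); rewrite /Q /= => /(_ (conj Ky _)).
    rewrite (ltW s0) (ltW sT) => /(_ isT) /=.
    by move: (penalty A t1 _) (penalty A t1 _) => pen pen'; rewrite /uenv; envelope_lra.
  have := out y s nKy; rewrite (ltW s0) (ltW sT) => /(_ isT).
  have := penalty_ge0 t1 (y, s) (ltW A0); move: pos.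
  by move: (penalty A t1 _) (penalty A t1 _) => pen pen'; rewrite /uenv; envelope_lra.
have P0 : 0 <= 2 * A * Num.max 0 ((x, t).2 - t1).
  by rewrite mulr_ge0// ?le_max ?lexx// mulr_ge0// ltW.
have := subv x t t0' _ _ _ Jv; rewrite !addr0; move: P0 slt.
by move: (2 * A * _) => P; envelope_lra.
Qed.

End Spacetime.

(** * Travelling waves bound the supports *)

(** The third power is the lowest one for which the power of the positive part
is twice continuously differentiable; its second order expansion then holds
with the remainder |h| ^ 3 on both sides of the kink. *)
Lemma max0_cube_taylor (R : realType) (s h : R) :
  Num.max 0 (s + h) ^+ 3 <= Num.max 0 s ^+ 3 + 3 * Num.max 0 s ^+ 2 * h +
    3 * Num.max 0 s * h ^+ 2 + `|h| ^+ 3.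
Proof.
rewrite -subr_ge0; case: (lerP 0 s) => s0; case: (lerP 0 (s + h)) => sh0.
- have -> : s ^+ 3 + 3 * s ^+ 2 * h + 3 * s * h ^+ 2 + `|h| ^+ 3 - (s + h) ^+ 3 =
    `|h| ^+ 3 - h ^+ 3 by ring.
  by rewrite subr_ge0 -normrX ler_norm.
- have h0 : h < 0 by lra.
  rewrite ltr0_norm//.
  have -> : s ^+ 3 + 3 * s ^+ 2 * h + 3 * s * h ^+ 2 + (- h) ^+ 3 - 0 ^+ 3 =
    (- (s + h)) ^+ 2 * (s + h) + 2 * (- h) ^+ 3 by ring.
  have : (- (s + h)) ^+ 3 <= (- h) ^+ 3 by rewrite lerXn2r ?nnegrE; lra.
  have : 0 <= (- h) ^+ 3 by rewrite exprn_ge0//; lra.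
  by rewrite !exprS expr0; lra.
- rewrite !expr0n /= !mulr0 !mul0r !add0r subr_ge0.
  apply: lerXn2r; rewrite ?nnegrE// (le_trans _ (ler_norm h))//; lra.
- by rewrite !expr0n /= !mulr0 !mul0r !add0r subr0 exprn_ge0.
Qed.

Section Barriers.
Context {R : realType} {n : nat}.
Notation V := 'rV[R]_n.
Notation M := 'M[R]_n.
Notation ST := (@spacetime R n).
Implicit Types (u v w phi : V * R -> R) (f g : V -> R) (z : V * R).

Lemma dot_sqr_le (e x : V) : nsq e = 1 -> dot e x ^+ 2 <= nsq x.
Proof.
move=> e1; have := nsq_ge0 (x - dot e x *: e).
rewrite nsqD nsqN nsqZ dotNr dotZr e1 (dotC x e) expr2; lra.
Qed.

Lemma dot_le_enorm (e x : V) : nsq e = 1 -> `|dot e x| <= enorm x.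
Proof.
move=> e1; rewrite enorm_sqrt -sqrtr_sqr ler_wsqrtr//; exact: dot_sqr_le.
Qed.

(** A planar front moving with speed 2 in the direction e. Its level sets are
hyperplanes, so that the curvature term vanishes and a flat front would move
with speed 1 only; the excess of speed leaves room for the source f. *)
Definition front (r : R) (e : V) z : R := r + 2 * z.2 - dot e z.1.
Definition wave (K r : R) (e : V) z : R := K * Num.max 0 (front r e z) ^+ 3.

Lemma dot_fst_continuous (e : V) : continuous (fun z : V * R => dot e z.1).
Proof.
move=> z; apply: (@continuous_comp _ _ _ (fun z : V * R => z.1) (dot e)).
  exact: cvg_fst.
exact: dot_continuous.
Qed.

Lemma nsq_fst_continuous (y : V) : continuous (fun z : V * R => nsq (z.1 - y)).
Proof.
move=> z; apply: (@continuous_comp _ _ _ (fun z : V * R => z.1 - y) nsq).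
  by apply: cvgB; [exact: cvg_fst|exact: cvg_cst].
exact: nsq_continuous.
Qed.

Lemma snd_continuous (c : R) : continuous (fun z : V * R => c * z.2).
Proof.
by move=> z; apply: cvgM; [exact: cvg_cst|exact: cvg_snd].
Qed.

Lemma wave_continuous K r e : continuous (wave K r e).
Proof.
move=> z; apply: cvgM; first exact: cvg_cst.
apply: (@continuous_comp _ _ _ (fun z => Num.max 0 (front r e z)) (fun a : R => a ^+ 3)).
  apply: (@continuous_comp _ _ _ (front r e) (fun x : R => Num.max 0 x)).
    apply: cvgB; last exact: dot_fst_continuous.
    apply: cvgD; first exact: cvg_cst.
    by apply: cvgM; [exact: cvg_cst|exact: cvg_snd].
  exact: max0_continuous.
exact: exprn_continuous.
Qed.

Lemma outer_sym (k : R) (e : V) : (k *: (e^T *m e))^T = k *: (e^T *m e).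
Proof. by rewrite linearZ /= trmx_mul trmxK. Qed.

Lemma qform_outer (k : R) (e x : V) : qform (k *: (e^T *m e)) x = k * dot e x ^+ 2.
Proof.
rewrite /qform -scalemxAr -scalemxAl mxE; congr (_ * _).
have -> : x *m (e^T *m e) *m x^T = (x *m e^T) *m (e *m x^T) by rewrite !mulmxA.
by rewrite [LHS]mxE big_ord1 -/(dot x e) -/(dot e x) (dotC x e) expr2.
Qed.

(** The front variable increases by h = 2 dt - dot e dx. In the expansion of its
cube, the part of h ^ 2 that involves dt and the cubic remainder are both
negligible with respect to |dt| + nsq dx. *)
Lemma wave_jet K r e z : 0 <= K -> nsq e = 1 ->
  let s := Num.max 0 (front r e z) in
  Jplus (wave K r e) z
    (- (3 * K * s ^+ 2) *: e, (6 * K * s) *: (e^T *m e), 6 * K * s ^+ 2).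
Proof.
move=> K0 e1 s; apply/JplusE; split; first exact: outer_sym.
move=> eps eps0.
have s0 : 0 <= s by rewrite /s le_max lexx.
pose dt (y : V * R) := y.2 - z.2; pose a (y : V * R) := dot e y.1 - dot e z.1.
pose h y := 2 * dt y - a y.
have cdt : dt @ z --> 0.
  by rewrite -(subrr z.2); apply: cvgB; [exact: cvg_snd|exact: cvg_cst].
have ca : a @ z --> 0.
  rewrite -(subrr (dot e z.1)); apply: cvgB; last exact: cvg_cst.
  exact: dot_fst_continuous.
have ch : h @ z --> 0.
  by rewrite -[0](subr0 0) -{1}(mulr0 2); apply: cvgB => //; apply: cvgM => //; exact: cvg_cst.
have n1 : \forall y \near z,
    K * (12 * s * `|dt y| + 12 * s * `|a y| + 8 * `|h y| * `|dt y|) < eps.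
  have cv : (fun y => K * (12 * s * `|dt y| + 12 * s * `|a y| + 8 * `|h y| * `|dt y|)) @ z
     --> K * (12 * s * `|0 : R| + 12 * s * `|0 : R| + 8 * `|0 : R| * `|0 : R|).
    apply: cvgM; first exact: cvg_cst.
    apply: cvgD; first apply: cvgD.
    - by apply: cvgM; [exact: cvg_cst|exact: cvg_norm].
    - by apply: cvgM; [exact: cvg_cst|exact: cvg_norm].
    - apply: cvgM; last exact: cvg_norm.
      by apply: cvgM; [exact: cvg_cst|exact: cvg_norm].
  by apply: (cvgr_lt _ cv); rewrite normr0 !mulr0 !addr0 mulr0.
have n2 : \forall y \near z, K * (2 * `|h y|) < eps.
  have cv : (fun y => K * (2 * `|h y|)) @ z --> K * (2 * `|0 : R|).
    apply: cvgM; first exact: cvg_cst.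
    by apply: cvgM; [exact: cvg_cst|exact: cvg_norm].
  by apply: (cvgr_lt _ cv); rewrite normr0 !mulr0.
apply: filterS2 n1 n2 => y.
rewrite /taylor /pdist qform_outer dotZl /wave.
rewrite -/(dt y) dotDr dotNr -/(a y).
have -> : front r e y = front r e z + h y by rewrite /front /h /dt /a; ring.
have := max0_cube_taylor (front r e z) (h y); rewrite -/s.
have an : a y ^+ 2 <= nsq (y.1 - z.1).
  by rewrite /a -dotNr -dotDr; exact: dot_sqr_le.
move: an; have := nsq_ge0 (y.1 - z.1); move: (nsq _) => N N0 an.
have hE : h y = 2 * dt y - a y by [].
move: (Num.max 0 (front r e z + h y) ^+ 3) => W; move: hE an.
move: (h y) (dt y) (a y) => H T A hE AN WT n1 n2.
have HH : H ^+ 2 <= 8 * `|T| ^+ 2 + 2 * N.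
  rewrite real_normK ?num_real//; have := sqr_ge0 (2 * T + A).
  have : H ^+ 2 + (2 * T + A) ^+ 2 = 8 * T ^+ 2 + 2 * A ^+ 2 by rewrite hE; ring.
  move: AN; lra.
have H3 : `|H| ^+ 3 <= 8 * `|H| * `|T| * `|T| + 2 * `|H| * N.
  have -> : `|H| ^+ 3 = `|H| * H ^+ 2 by rewrite -[H ^+ 2]real_normK ?num_real// -exprS.
  have -> : 8 * `|H| * `|T| * `|T| + 2 * `|H| * N = `|H| * (8 * `|T| ^+ 2 + 2 * N) by ring.
  exact: ler_wpM2l.
have cross : 3 * s * (H ^+ 2 - A ^+ 2) <= 12 * s * `|T| * `|T| + 12 * s * `|A| * `|T|.
  have -> : 3 * s * (H ^+ 2 - A ^+ 2) = 12 * s * (T ^+ 2 - T * A) by rewrite hE; ring.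
  have -> : 12 * s * `|T| * `|T| + 12 * s * `|A| * `|T| = 12 * s * (`|T| ^+ 2 + `|T * A|).
    by rewrite normrM; ring.
  apply: ler_wpM2l; first by rewrite mulr_ge0.
  rewrite real_normK ?num_real// lerD2l -normrN; exact: ler_norm.
have KW := ler_wpM2l K0 (le_trans WT (lerD (lexx _) H3)).
have e1T : K * (12 * s * `|T| + 12 * s * `|A| + 8 * `|H| * `|T|) * `|T| <= eps * `|T|.
  by apply: ler_wpM2r => //; exact: ltW.
have e2N : K * (2 * `|H|) * N <= eps * N.
  by apply: ler_wpM2r => //; exact: ltW.
have Kc := ler_wpM2l K0 cross.
apply: (le_trans KW); move: e1T e2N Kc; clear -hE; move: `|H| => h'; rewrite hE.
move: `|T| `|A| => t a'; lra.
Qed.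

End Barriers.

Section UpperBarriers.
Context {R : realType} {n : nat}.
Notation V := 'rV[R]_n.
Notation M := 'M[R]_n.
Notation ST := (@spacetime R n).
Implicit Types (u v w phi : V * R -> R) (z : V * R).

Definition cube (rho : R) : set V := [set x | forall i, `|x 0 i| <= rho].

Lemma cube_compact rho : compact (cube rho).
Proof.
have := @rV_compact R n (fun=> `[- rho, rho]%classic) (fun=> @segment_compact _ _ _).
rewrite (_ : [set v | _] = cube rho)//.
by apply/seteqP; split=> x /= H i; have := H i; rewrite in_itv /= ler_norml.
Qed.

Lemma not_cube rho (x : V) : ~ cube rho x -> exists i, rho < `|x 0 i|.
Proof.
move=> nc; apply: contrapT => H; apply: nc => i; rewrite leNgt; apply/negP => lt.
by apply: H; exists i.
Qed.

Lemma uenv_le0_outside v (T : R) : locally_bounded v -> compactly_supported_in_space v ->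
  0 < T -> exists2 rho, 0 < rho &
    forall (x : V) (t : R), ~ cube rho x -> 0 <= t < T -> uenv v (x, t) <= 0.
Proof.
move=> lb cs T0; have [rho rho0 H] := cs T T0; exists rho => // x t.
move=> /not_cube[i lt] /andP[t0 tT].
apply: (@uenv_le_continuous _ _ v (fun=> 0)) => //; first exact: cst_continuous.
rewrite near_withinE.
have n1 : nbhs (x, t) [set z : V * R | z.2 < T].
  have cv : (fun z : V * R => z.2) @ (x, t) --> t by exact: cvg_snd.
  exact: (cvgr_lt _ cv).
have n2 : nbhs (x, t) [set z : V * R | rho < `|z.1 0 i|].
  have cv : (fun z : V * R => z.1 0 i) @ (x, t) --> x 0 i.
    have c1 : (fun z : V * R => z.1) @ (x, t) --> x by exact: cvg_fst.
    exact: (cvg_comp _ _ c1 (@coord_continuous R 1 n 0 i x)).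
  have cv' : (fun z : V * R => `|z.1 0 i|) @ (x, t) --> `|x 0 i| by exact: cvg_norm.
  exact: (cvgr_gt _ cv').
apply: filterS2 n1 n2 => -[y s] /= sT ylt s0; rewrite H//.
  rewrite /eball /= subr0 => /ltW le.
  by have := coord_le_enorm y i; rewrite leNgt => /negP; apply; apply: le_lt_trans ylt.
by rewrite s0 ltW.
Qed.

Context (n0 : (0 < n)%N) (f g : V -> R) (Mf Mg r : R).
Context (f_ge0 : forall x, 0 <= f x) (f_le : forall x, f x <= Mf).
Context (g_ge0 : forall x, 0 <= g x) (g_le : forall x, g x <= Mg).
Context (g_cont : continuous g) (r0 : 0 < r).
Context (supp_g : supp g `<=` eball 0 r) (supp_f : supp f `<=` eball 0 r).

Definition admissible v := subsolution f g v /\ compactly_supported_in_space v.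

Lemma f_bounded_near (x : V) : bounded_near f (within setT (nbhs x)).
Proof.
apply: (@bounded_near_le _ _ _ _ (fun=> Mf)); first exact: cst_continuous.
by near=> y; rewrite ger0_norm.
Unshelve. all: by end_near. Qed.

Lemma mem_closureT (x : V) : closure setT x.
Proof. exact: subset_closure. Qed.

Lemma usc_f_ge0 x : 0 <= usc_env setT f x.
Proof.
apply: usc_env_ge; [exact: mem_closureT|exact: f_bounded_near|].
by near=> y.
Unshelve. all: by end_near. Qed.

Lemma usc_f_le x : usc_env setT f x <= Mf.
Proof.
apply: usc_env_le; [exact: mem_closureT|exact: f_bounded_near|].
by near=> y.
Unshelve. all: by end_near. Qed.

Lemma usc_f_outside x : ~ supp f x -> usc_env setT f x <= 0.
Proof.
move=> nx; apply: usc_env_le; [exact: mem_closureT|exact: f_bounded_near|].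
rewrite near_withinE.
have : nbhs x (~` supp f).
  by apply: open_nbhs_nbhs; split => //; apply: closed_openC; exact: closed_closure.
apply: filterS => y /= ny _; have [->//|fy] := eqVneq (f y) 0.
by exfalso; apply: ny; apply: subset_closure.
Qed.

Lemma bound_f_ge0 : 0 <= Mf. Proof. exact: le_trans (f_le 0). Qed.
Lemma bound_g_ge0 : 0 <= Mg. Proof. exact: le_trans (g_le 0). Qed.

Let K := Mf + Mg + 1.
Let K1 : 1 <= K. Proof. by rewrite /K; have := bound_f_ge0; have := bound_g_ge0; lra. Qed.
Let K0 : 0 <= K. Proof. exact: le_trans K1. Qed.

Lemma front_ge1 (e x : V) (t : R) : nsq e = 1 -> 0 <= t -> eball 0 r x ->
  1 <= front (r + 1) e (x, t).
Proof.
move=> e1 t0; rewrite /eball /= subr0 => xr.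
have := dot_le_enorm x e1; rewrite ler_norml => /andP[_ le].
rewrite /front /=; move: t0 xr le; lra.
Qed.

(** On the support of f the front variable s is at least 1, and the gain 3 K s ^
2 of speed 2 over speed 1 exceeds f; off the support f vanishes and eta
alone gives the strict inequality. Where s = 0 the gradient vanishes and the
lower envelope of the Hamiltonian at the origin comes in. *)
Lemma wave_strict (e x : V) (t eta s : R) : nsq e = 1 -> 0 <= t -> 0 < eta ->
  s = Num.max 0 (front (r + 1) e (x, t)) ->
  usc_env setT f x < (6 * K * s ^+ 2 + eta) +
     Hlow (- (3 * K * s ^+ 2) *: e, (6 * K * s) *: (e^T *m e)).
Proof.
move=> e1 t0 eta0 sE.
have s0 : 0 <= s by rewrite sE le_max lexx.
have fx : usc_env setT f x <= Mf by exact: usc_f_le.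
have fs : usc_env setT f x <= 3 * K * s ^+ 2.
  have [sx|nx] := pselect (supp f x); last first.
    by apply: le_trans (usc_f_outside nx) _; rewrite mulr_ge0 ?sqr_ge0// mulr_ge0.
  have s1 : 1 <= s by rewrite sE le_max front_ge1 ?orbT//; exact: supp_f.
  apply: (le_trans fx); apply: (@le_trans _ _ (3 * K * 1)).
    have := bound_g_ge0; have := bound_f_ge0; rewrite /K; lra.
  rewrite ler_wpM2l//; first by rewrite mulr_ge0.
  by rewrite expr_ge1.
have Hl : - (3 * K * s ^+ 2) <=
    Hlow (- (3 * K * s ^+ 2) *: e, (6 * K * s) *: (e^T *m e)).
  have [sz|sn] := eqVneq s 0.
    rewrite sz expr0n /= !mulr0 oppr0 !scale0r.
    apply: le_trans (Hlow_ge n0 _ _); last by rewrite trmx0.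
    by rewrite normr0 mulr0 sub0r enorm_sqrt nsq0 sqrtr0 oppr0.
  have sp : 0 < s by rewrite lt_def sn.
  have cp : 0 < 3 * K * s ^+ 2.
    by rewrite !mulr_gt0// ?exprn_gt0//; apply: lt_le_trans K1.
  have en : enorm (- (3 * K * s ^+ 2) *: e) = 3 * K * s ^+ 2.
    by rewrite enorm_sqrt nsqZ e1 mulr1 sqrrN sqrtr_sqr ger0_norm// ltW.
  have p0 : - (3 * K * s ^+ 2) *: e != 0.
    apply/negP => /eqP e0; move: en; rewrite e0 enorm_sqrt nsq0 sqrtr0 => c0.
    by move: cp; rewrite -c0 ltxx.
  apply: le_trans (Hlow_ge_Hval n0 (outer_sym _ _) p0).
  rewrite /Hval /= en qform_outer dotZr nsqZ -nsq_dot e1 !mulr1.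
  have -> : \tr ((6 * K * s) *: (e^T *m e)) = 6 * K * s.
    by rewrite mxtraceZ mxtrace_mulC /mxtrace big_ord1 -/(dot e e) -nsq_dot e1 mulr1.
  rewrite [_^-1 * _]mulrCA mulVf ?mulr1 ?subrr ?oppr0 ?sub0r//.
  by rewrite expf_neq0// oppr_eq0 gt_eqF.
apply: (@lt_le_trans _ _ (3 * K * s ^+ 2 + eta)).
  by rewrite (le_lt_trans fs)// ltrDl.
rewrite -lerBlDl.
by have -> : 3 * K * s ^+ 2 + eta - (6 * K * s ^+ 2 + eta) = - (3 * K * s ^+ 2) by ring.
Qed.

(** The barrier is made strict by the term eta * t, and eta tends to 0
afterwards. *)
Lemma wave_barrier v (e x : V) (t : R) : admissible v -> nsq e = 1 -> 0 <= t ->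
  uenv v (x, t) <= wave K (r + 1) e (x, t).
Proof.
move=> [subv csv] e1 t0; apply/ler_addgt0Pr => eps eps0.
have tp : 0 < t + 1 by rewrite ltr_wpDl.
set eta := eps / (t + 1).
have eta0 : 0 < eta by rewrite divr_gt0.
pose phi := wave K (r + 1) e \+ (fun z => eta * z.2).
have wge0 z : 0 <= wave K (r + 1) e z.
  by rewrite mulr_ge0// exprn_ge0// le_max lexx.
have [lbv _ _] := subv.
have T0 : 0 < t + 2 by rewrite ltr_wpDl.
have [rho rho0 out] := uenv_le0_outside lbv csv T0.
have := @comparison _ _ f g v phi (cube rho) (t + 1) subv (@cube_compact rho).
move=> /(_ _ _ _ _ x t) cmp.
apply: (@le_trans _ _ (phi (x, t))); last first.
  rewrite /phi /= lerD2l /eta mulrAC ler_pdivrMr// ler_wpM2l// ?ltW//.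
  by rewrite ltrDl.
apply: cmp; last by rewrite t0 ltrDl ltr01.
- by move=> z; apply: cvgD; [exact: wave_continuous|exact: snd_continuous].
- move=> y s ny /andP[s0 sT]; apply: le_trans (out y s ny _) _.
    by rewrite s0 (le_lt_trans sT)// ltrD2l ltr1n.
  by rewrite /phi /= addr_ge0// mulr_ge0// ltW.
- move=> y; rewrite /phi /= mulr0 addr0.
  have [->//|gy] := eqVneq (g y) 0.
  have s1 : 1 <= Num.max 0 (front (r + 1) e (y, 0)).
    by rewrite le_max front_ge1 ?orbT//; apply: supp_g; exact: subset_closure.
  apply: (le_trans (g_le y)); apply: (@le_trans _ _ (K * 1)).
    have := bound_f_ge0; rewrite /K; lra.
  by rewrite /wave ler_wpM2l// exprn_ege1.
move=> y s cy /andP[s0 sT] _.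
have J2 : Jplus (fun z : V * R => eta * z.2) (y, s) (0, 0, eta).
  apply: (@Jplus_taylor _ _ _ _ _ _ _ 0); first by rewrite trmx0.
  near=> z; rewrite /taylor dot0l qform0 /=; lra.
have J := JplusD (wave_jet (r + 1) (y, s) K0 e1) J2.
rewrite !addr0 in J.
eexists; eexists; eexists; split; first exact: J.
exact: wave_strict e1 (ltW s0) eta0 erefl.
Unshelve. all: by end_near. Qed.

End UpperBarriers.

(** * Paraboloids control the initial values *)

Section Parabola.
Context {R : realType} {n : nat}.
Notation V := 'rV[R]_n.
Notation M := 'M[R]_n.
Notation ST := (@spacetime R n).
Implicit Types (u v w phi : V * R -> R) (z : V * R).

Definition parabola (a C k : R) (y : V) z : R := a + C * nsq (z.1 - y) + k * z.2.

Lemma parabola_continuous a C k y : continuous (parabola a C k y).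
Proof.
move=> z; apply: cvgD; last exact: snd_continuous.
apply: cvgD; first exact: cvg_cst.
by apply: cvgM; [exact: cvg_cst|exact: nsq_fst_continuous].
Qed.

Lemma parabola_taylor a C k y z1 z : parabola a C k y z =
  parabola a C k y z1 + taylor ((2 * C) *: (z1.1 - y)) (2 * C)%:M k z1 z.
Proof.
rewrite /parabola /taylor qform_scalar dotZl.
have -> : z.1 - y = (z1.1 - y) + (z.1 - z1.1) by rewrite [RHS]addrC addrA subrK.
by rewrite nsqD; field.
Qed.

Lemma parabola_jet a C k y z : Jplus (parabola a C k y) z
  ((2 * C) *: (z.1 - y), (2 * C)%:M, k).
Proof.
apply: (@Jplus_taylor _ _ _ _ _ _ _ 0); first by rewrite tr_scalar_mx.
by near=> w; rewrite mul0r addr0 -parabola_taylor.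
Unshelve. all: by end_near. Qed.

Lemma parabola_support (a C : R) (y x : V) : 0 < C ->
  1 + 2 * nsq y + 2 * (`|a| / C) <= enorm x -> a - C * nsq (x - y) <= 0.
Proof.
move=> C0 le; have x1 : 1 <= enorm x.
  by apply: le_trans le; rewrite -addrA lerDl addr_ge0// mulr_ge0 ?nsq_ge0// divr_ge0// ltW.
have x2 : enorm x <= nsq x by rewrite /nsq ler_eXnr.
have := nsqD_le (x - y) y; rewrite subrK => x3.
have aC : C * (`|a| / C) = `|a| by rewrite mulrC divfK// gt_eqF.
have : C * (`|a| / C) <= C * nsq (x - y).
  by rewrite ler_wpM2l// ?ltW//; move: le x2 x3; lra.
rewrite aC; have := ler_norm a; lra.
Qed.

(** Continuity gives the bound near x, and at distance at least d from x the
quadratic term alone exceeds the bound B of g. *)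
Lemma continuous_parabola_above (g : V -> R) (x : V) (B eps : R) :
  {for x, continuous g} -> 0 <= B -> (forall y, g y <= B) -> 0 <= g x -> 0 < eps ->
  exists2 C, 0 < C & forall y, g y <= g x + eps + C * nsq (y - x).
Proof.
move=> gc B0 gB gx eps0.
have : \forall y \near x, g y < g x + eps by apply: (cvgr_lt _ gc); rewrite ltrDl.
move=> /nbhs_ballP[d /= d0 gd].
have C0 : 0 < (B + 1) / d ^+ 2 by rewrite divr_gt0 ?exprn_gt0// ltr_wpDl.
exists ((B + 1) / d ^+ 2) => // y.
have N0 := nsq_ge0 (y - x); have [lt|ge] := ltP `|x - y| d.
  have : g y < g x + eps by apply: gd; rewrite -ball_normE.
  by have := mulr_ge0 (ltW C0) N0; lra.
have dn : d ^+ 2 <= nsq (y - x).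
  rewrite -nsqN opprB lerXn2r ?nnegrE ?enorm_ge0 ?(ltW d0)//.
  exact: le_trans ge (mxnorm_le_enorm _).
have : (B + 1) / d ^+ 2 * d ^+ 2 <= (B + 1) / d ^+ 2 * nsq (y - x).
  by rewrite ler_wpM2l// ltW.
rewrite divfK ?gt_eqF ?exprn_gt0//; have := gB y; move: gx eps0; lra.
Qed.

Lemma cube_nsq_le rho (x : V) : cube rho x -> nsq x <= n%:R * rho ^+ 2.
Proof.
move=> cx; rewrite nsqE mulr_natl.
have <- : \sum_(i < n) rho ^+ 2 = rho ^+ 2 *+ n by rewrite sumr_const card_ord.
apply: ler_sum => i _; rewrite -real_normK ?num_real//.
by rewrite lerXn2r ?nnegrE// (le_trans (normr_ge0 _) (cx i)).
Qed.

Lemma enorm_le1D (x : V) : enorm x <= 1 + nsq x.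
Proof. by rewrite /nsq; have := sqr_ge0 (enorm x - 1); rewrite sqrrB; have := enorm_ge0 x; lra. Qed.

End Parabola.

Section AdmissibleBounds.
Context {R : realType} {n : nat}.
Notation V := 'rV[R]_n.
Notation M := 'M[R]_n.
Notation ST := (@spacetime R n).
Implicit Types (u v w phi : V * R -> R) (z : V * R).
Context (n0 : (0 < n)%N) (f g : V -> R) (Mf Mg r : R).
Context (f_ge0 : forall x, 0 <= f x) (f_le : forall x, f x <= Mf).
Context (g_ge0 : forall x, 0 <= g x) (g_le : forall x, g x <= Mg).
Context (g_cont : continuous g) (r0 : 0 < r).
Context (supp_g : supp g `<=` eball 0 r) (supp_f : supp f `<=` eball 0 r).

(** If the i-th coordinate of x is too large, the wave travelling along the i-th
axis towards x has not reached it at time t. *)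
Lemma admissible_support v (x : V) (t T : R) : admissible f g v -> 0 <= t <= T ->
  ~ cube (r + 1 + 2 * T) x -> uenv v (x, t) <= 0.
Proof.
move=> Sv /andP[t0 tT] /not_cube[i xi].
pose e : V := Num.sg (x 0 i) *: delta_mx 0 i.
have de : dot (delta_mx 0 i) x = x 0 i by rewrite /dot -rowE !mxE.
have xi0 : x 0 i != 0.
  apply/eqP => x0; move: xi; rewrite x0 normr0; move: r0 t0 tT; lra.
have e1 : nsq e = 1.
  rewrite nsqZ nsq_dot /dot -rowE !mxE !eqxx mulr1.
  by rewrite -[_ ^+ 2]real_normK ?num_real// normr_sg xi0 expr1n.
apply: le_trans (wave_barrier n0 f_ge0 f_le g_ge0 g_le supp_g supp_f x Sv e1 t0) _.
rewrite /wave max_l ?expr0n ?mulr0//.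
rewrite /front /= dotZl de -normrEsg; move: xi tT; lra.
Qed.

(** A paraboloid growing fast enough in time is a strict supersolution on any
bounded set, and all the admissible functions vanish outside a common cube
up to time 1. *)
Lemma admissible_initial_bound (x0 : V) (eps : R) : 0 < eps ->
  exists2 phi, continuous phi & phi (x0, 0) = g x0 + eps /\
    forall v, admissible f g v -> forall x t, 0 <= t < 1 -> uenv v (x, t) <= phi (x, t).
Proof.
move=> eps0.
have Mg0 := bound_g_ge0 g_ge0 g_le.
have [C C0 Cg] := continuous_parabola_above (@g_cont x0) Mg0 g_le (g_ge0 x0) eps0.
set rho := r + 1 + 2 * 1.
pose N := 1 + (2 * (n%:R * rho ^+ 2) + 2 * nsq x0).
have Mf0 := bound_f_ge0 f_ge0 f_le.
pose k := Mf + 1 + @Hconst R n * `|(2 * C)%:M : M| + 2 * C * N.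
have N0 : 0 <= N.
  by rewrite !addr_ge0// mulr_ge0 ?nsq_ge0// mulr_ge0// sqr_ge0.
have k0 : 0 <= k.
  by rewrite !addr_ge0// !mulr_ge0// ?Hconst_ge0// ltW.
have phi0 x t : 0 <= t -> 0 <= parabola (g x0 + eps) C k x0 (x, t).
  move=> t0; rewrite /parabola /=; apply: addr_ge0; last exact: mulr_ge0.
  apply: addr_ge0; first by rewrite addr_ge0// ltW.
  by rewrite mulr_ge0 ?nsq_ge0// ltW.
exists (parabola (g x0 + eps) C k x0); first exact: parabola_continuous.
split; first by rewrite /parabola /= subrr nsq0 !mulr0 !addr0.
move=> v [subv csv]; apply: (@comparison _ _ f g v _ (cube rho)) => //.
- exact: cube_compact.
- exact: parabola_continuous.
- move=> x t nx t01; apply: (@le_trans _ _ 0).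
    exact: (admissible_support (conj subv csv) t01 nx).
  by apply: phi0; case/andP: t01.
- by move=> x; rewrite /parabola /= mulr0 addr0.
move=> x t cx _ _; eexists; eexists; eexists; split; first exact: parabola_jet.
have symC : ((2 * C)%:M : M)^T = (2 * C)%:M by rewrite tr_scalar_mx.
apply: (@lt_le_trans _ _
  (k + (- @Hconst R n * `|(2 * C)%:M : M| - enorm ((2 * C) *: (x - x0))))); last first.
  by rewrite lerD2l; exact: Hlow_ge.
apply: le_lt_trans (usc_f_le f_ge0 f_le x) _.
have : enorm ((2 * C) *: (x - x0)) <= 2 * C * N.
  have -> : enorm ((2 * C) *: (x - x0)) = 2 * C * enorm (x - x0).
    rewrite enorm_sqrt nsqZ sqrtrM ?sqr_ge0// sqrtr_sqr -enorm_sqrt ger0_norm//.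
    by rewrite mulr_ge0// ltW.
  rewrite ler_wpM2l//; first by rewrite mulr_ge0// ltW.
  apply: le_trans (enorm_le1D _) _; rewrite lerD2l.
  apply: le_trans (nsqD_le _ _) _; rewrite nsqN lerD2r ler_wpM2l//.
  exact: cube_nsq_le.
rewrite /k mulNr; move: (enorm _) (2 * C * N) => e b.
by move: (@Hconst R n * _) => h; lra.
Unshelve. all: by end_near. Qed.

(** A paraboloid that sinks fast enough is a classical subsolution, and so is 0
because f is nonnegative. The maximum of the two lies above both, so that at
each point its superjets are compared with the jet of the one that is
attained. *)
Lemma parabola_admissible (a C : R) (x0 : V) : 0 < C ->
  (forall x, a - C * nsq (x - x0) <= g x) ->
  exists2 k, 0 <= k &
    admissible f g (fun z => Num.max 0 (parabola a (- C) (- k) x0 z)).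
Proof.
move=> C0 below; set X0 : M := (2 * - C)%:M.
pose k := @Hconst R n * `|X0|.
have k0 : 0 <= k by rewrite mulr_ge0// Hconst_ge0.
exists k => //; set q := parabola a (- C) (- k) x0; set v := fun z => _.
have cv : continuous v.
  move=> z; apply: (@continuous_comp _ _ _ q (fun x : R => Num.max 0 x)).
    exact: parabola_continuous.
  exact: max0_continuous.
have v0 z : 0 <= v z by rewrite /v le_max lexx.
have lbv : locally_bounded v.
  by apply: (@locally_bounded_le _ _ _ v cv) => z _; rewrite ger0_norm.
have uv z : ST z -> uenv v z = v z.
  move=> Sz; apply/eqP; rewrite eq_le uenv_ub// andbT.
  apply: (@uenv_le_continuous _ _ v v z lbv Sz (cv z)); rewrite near_withinE.
  by near=> y.
split; first split=> //.
- move=> x; rewrite -/(uenv v (x, 0)) uv /spacetime//= /v ge_max g_ge0 /=.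
  by rewrite /q /parabola /= mulr0 addr0 mulNr.
- move=> x t t0 p X tau; rewrite -/(uenv v) => J; have f0 := usc_f_ge0 f_ge0 f_le x.
  apply: le_trans f0.
  have Sz : ST (x, t) by exact: ltW.
  have [symX _] := J.
  have near_ge (b : V * R -> R) : (forall z, b z <= v z) ->
      \forall z \near (x, t), b z <= uenv v z.
    move=> bv; have := @near_positive_time _ _ (x, t) t0; apply: filterS => z z0.
    by rewrite uv// /spacetime /= ltW.
  have H0 : Hlow ((0 : V), (0 : M)) <= 0.
    have s0 : (0 : M)^T = 0 by rewrite trmx0.
    apply: le_trans (Hlow_le_Hup n0 _ s0) _; apply: le_trans (Hup_le n0 _ s0) _.
    by rewrite normr0 mulr0.
  have [q0|q0] := leP (q (x, t)) 0.
    have [|-> -> XX] := @Jplus_touching _ _ _ _ _ _ _ 0 0 0 0 J.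
      have vx : v (x, t) = 0 by rewrite /v max_l.
      have := near_ge (fun=> 0) v0; apply: filterS => z.
      have -> : taylor 0 0 0 (x, t) z = 0 by rewrite /taylor dot0l qform0; ring.
      by rewrite (uv (x, t))// vx mul0r subr0 addr0.
    rewrite add0r; apply: le_trans H0; apply: Hlow_elliptic => //; first by rewrite trmx0.
  have symX0 : X0^T = X0 by rewrite tr_scalar_mx.
  have [|-> -> XX] := @Jplus_touching _ _ _ _ _ _ _ ((2 * - C) *: (x - x0)) X0 (- k) 0 J.
    have qv z : q z <= v z by rewrite /v le_max lexx orbT.
    have vx : v (x, t) = q (x, t) by rewrite /v max_r// ltW.
    have := near_ge q qv; apply: filterS => z.
    by rewrite (uv (x, t))// vx mul0r subr0 {1}/q (parabola_taylor _ _ _ _ (x, t) z).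
  rewrite addrC subr_le0; apply: le_trans (Hlow_elliptic n0 _ symX0 symX XX) _.
  by apply: le_trans (Hlow_le_Hup n0 _ symX0) _; exact: Hup_le.
- move=> T T0; exists (1 + 2 * nsq x0 + 2 * (`|a| / C)).
    by rewrite -addrA ltr_pwDl// addr_ge0// mulr_ge0 ?nsq_ge0// divr_ge0// ltW.
  move=> x t; rewrite /eball /= subr0 => /negP; rewrite -leNgt => xl /andP[t0 _].
  rewrite /v max_l// /q /parabola /=.
  have := parabola_support C0 xl; have := mulr_ge0 k0 t0; lra.
Unshelve. all: by end_near. Qed.

End AdmissibleBounds.

(** * Smooth test functions with a strict contact *)

Section TestFunctions.
Context {R : realType} {n : nat}.
Notation V := 'rV[R]_n.
Notation M := 'M[R]_n.
Notation ST := (@spacetime R n).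
Implicit Types (u v w phi : V * R -> R) (z : V * R) (p : V) (X : M).

(** The absolute value of the time increment in the definition of the jets is not
differentiable. It is dominated by smooth_abs, with derivative smooth_sign. *)
Definition smooth_abs (mu s : R) : R := Num.sqrt (s ^+ 2 + mu ^+ 2).
Definition smooth_sign (mu s : R) : R := s / smooth_abs mu s.

Lemma smooth_abs_ge mu s : `|s| <= smooth_abs mu s.
Proof. by rewrite -sqrtr_sqr ler_wsqrtr// lerDl sqr_ge0. Qed.

Lemma smooth_abs0 mu : 0 <= mu -> smooth_abs mu 0 = mu.
Proof. by move=> mu0; rewrite /smooth_abs expr0n add0r sqrtr_sqr ger0_norm. Qed.

Lemma smooth_abs_ge_mu mu s : 0 <= mu -> mu <= smooth_abs mu s.
Proof.
move=> mu0; rewrite -{1}(ger0_norm mu0) -sqrtr_sqr ler_wsqrtr// lerDr; exact: sqr_ge0.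
Qed.

Lemma smooth_sign_le1 mu s : 0 < mu -> `|smooth_sign mu s| <= 1.
Proof.
move=> mu0; have a0 : 0 < smooth_abs mu s by apply: lt_le_trans (smooth_abs_ge_mu s (ltW mu0)).
by rewrite /smooth_sign normrM normfV (gtr0_norm a0) ler_pdivrMr// mul1r smooth_abs_ge.
Qed.

(** The inequality of means bounds a square root: if a is the value at s, then b
<= (b ^ 2 / a + a) / 2, and b ^ 2 is a polynomial in the increment. *)
Lemma smooth_abs_taylor mu s t : 0 < mu -> smooth_abs mu t <=
  smooth_abs mu s + smooth_sign mu s * (t - s) + (t - s) ^+ 2 / (2 * mu).
Proof.
move=> mu0; set a := smooth_abs mu s.
have am : mu <= a by exact: smooth_abs_ge_mu (ltW mu0).
have a0 : 0 < a by apply: lt_le_trans am.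
have a2 : a ^+ 2 = s ^+ 2 + mu ^+ 2 by rewrite sqr_sqrtr// addr_ge0// sqr_ge0.
have b2 : smooth_abs mu t ^+ 2 = t ^+ 2 + mu ^+ 2.
  by rewrite sqr_sqrtr// addr_ge0// sqr_ge0.
apply: (@le_trans _ _ ((smooth_abs mu t ^+ 2 / a + a) / 2)).
  rewrite ler_pdivlMr// -subr_ge0.
  have -> : smooth_abs mu t ^+ 2 / a + a - smooth_abs mu t * 2 =
     (smooth_abs mu t - a) ^+ 2 / a by field; rewrite gt_eqF.
  by rewrite divr_ge0 ?sqr_ge0// ltW.
have -> : (smooth_abs mu t ^+ 2 / a + a) / 2 =
    a + smooth_sign mu s * (t - s) + (t - s) ^+ 2 / (2 * a).
  have -> : smooth_abs mu t ^+ 2 = a ^+ 2 + 2 * s * (t - s) + (t - s) ^+ 2.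
    by rewrite b2 a2; ring.
  by rewrite /smooth_sign -/a; field; rewrite gt_eqF.
rewrite lerD2l ler_wpM2l ?sqr_ge0// lef_pV2 ?posrE ?mulr_gt0//.
by rewrite ler_wpM2l.
Qed.

(** A quadratic test function corrected by a multiple of a smooth version of
the parabolic distance. *)
Definition test (kappa mu : R) p X (tau : R) z0 z : R :=
  taylor p X tau z0 z +
  kappa * (smooth_abs mu (z.2 - z0.2) + nsq (z.1 - z0.1)).

Definition test_grad (kappa : R) p X (dx : V) : V := p + (dx *m X + (2 * kappa) *: dx).
Definition test_hess (kappa : R) X : M := X + (2 * kappa)%:M.

(** The gap is the error made in smooth_abs_taylor; keeping it in an identity
serves both signs of kappa. *)
Lemma test_taylor kappa mu p X tau z0 z1 z : 0 < mu -> X^T = X ->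
  exists2 gap, 0 <= gap & test kappa mu p X tau z0 z = test kappa mu p X tau z0 z1 +
    taylor (test_grad kappa p X (z1.1 - z0.1)) (test_hess kappa X)
      (tau + kappa * smooth_sign mu (z1.2 - z0.2)) z1 z +
    kappa / (2 * mu) * (z.2 - z1.2) ^+ 2 - kappa * gap.
Proof.
move=> mu0 symX.
exists (smooth_abs mu (z1.2 - z0.2) + smooth_sign mu (z1.2 - z0.2) * (z.2 - z1.2) +
    (z.2 - z1.2) ^+ 2 / (2 * mu) - smooth_abs mu (z.2 - z0.2)).
  rewrite subr_ge0; have := smooth_abs_taylor (z1.2 - z0.2) (z.2 - z0.2) mu0.
  by rewrite opprB addrA subrK.
rewrite /test /taylor /test_grad /test_hess.
have -> : z.1 - z0.1 = (z1.1 - z0.1) + (z.1 - z1.1) by rewrite [RHS]addrC addrA subrK.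
move: (z1.1 - z0.1) (z.1 - z1.1) => dx dz.
rewrite qform_add// !nsqD !dotDr !dotDl dotZl qformD qform_scalar.
by field; rewrite gt_eqF.
Qed.

Lemma pdist_continuous z0 : continuous (pdist z0).
Proof.
move=> z; apply: cvgD; last exact: nsq_fst_continuous.
apply: cvg_norm; apply: cvgB; [exact: cvg_snd|exact: cvg_cst].
Qed.

Lemma pdistxx z0 : pdist z0 z0 = 0.
Proof. by rewrite /pdist !subrr normr0 nsq0 addr0. Qed.

Lemma pdist_near z0 z (e : R) : pdist z0 z < e -> \forall y \near z, pdist z0 y < e.
Proof. by move=> lt; exact: (cvgr_lt _ (@pdist_continuous z0 z)). Qed.

Lemma nbhs_pdist z0 (P : set (V * R)) : nbhs z0 P ->
  exists2 e, 0 < e & forall z, pdist z0 z < e -> P z.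
Proof.
move=> /nbhs_ballP[d /= d0 dP]; exists (Num.min d (d ^+ 2)).
  by rewrite lt_min d0 exprn_gt0.
move=> z; rewrite lt_min => /andP[l1 l2]; apply: dP.
have nn := nsq_ge0 (z.1 - z0.1); have dn := normr_ge0 (z.2 - z0.2).
split; rewrite -ball_normE /=.
  have : enorm (z0.1 - z.1) < d.
    rewrite enorm_sqrt -(ger0_norm (ltW d0)) -sqrtr_sqr ltr_sqrt ?exprn_gt0//.
    by rewrite -nsqN opprB; move: l2 dn; rewrite /pdist; lra.
  exact: le_lt_trans (mxnorm_le_enorm _).
by rewrite distrC; move: l1 nn; rewrite /pdist; lra.
Qed.

Lemma test_continuous kappa mu p X tau z0 : continuous (test kappa mu p X tau z0).
Proof.
move=> z.
have c1 : (fun z : V * R => z.1 - z0.1) @ z --> z.1 - z0.1.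
  by apply: cvgB; [exact: cvg_fst|exact: cvg_cst].
have c2 : (fun z : V * R => z.2 - z0.2) @ z --> z.2 - z0.2.
  by apply: cvgB; [exact: cvg_snd|exact: cvg_cst].
apply: cvgD.
  apply: cvgD; first apply: cvgD.
  - by apply: cvgM; [exact: cvg_cst|exact: c2].
  - exact: (cvg_comp _ _ c1 (@dot_continuous R n p _)).
  - apply: cvgM; first exact: cvg_cst.
    exact: (cvg_comp _ _ c1 (@qform_continuous R n X _)).
apply: cvgM; first exact: cvg_cst.
apply: cvgD; last exact: nsq_fst_continuous.
have c3 : (fun z : V * R => (z.2 - z0.2) ^+ 2 + mu ^+ 2) @ z --> (z.2 - z0.2) ^+ 2 + mu ^+ 2.
  apply: cvgD; last exact: cvg_cst.
  exact: (cvg_comp _ _ c2 (@exprn_continuous R 2 _)).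
exact: (cvg_comp _ _ c3 (@sqrt_continuous R _)).
Qed.

Definition pball z0 (rho : R) : set (V * R) := [set z | pdist z0 z <= rho].

Lemma pball_compact z0 rho : compact (pball z0 rho).
Proof.
pose A i := `[z0.1 0 i - (rho + 1), z0.1 0 i + (rho + 1)]%classic.
have cA : compact [set x : V | forall i, A i (x 0 i)].
  by apply: (@rV_compact R n A) => i; exact: segment_compact.
have cB := compact_setX cA (@segment_compact R (z0.2 - rho) (z0.2 + rho)).
apply: subclosed_compact cB _.
  rewrite (_ : pball _ _ = pdist z0 @^-1` [set a | a <= rho])//.
  by apply: closed_comp => [z _|]; [exact: pdist_continuous|exact: closed_le].
move=> z /= zr; have nn := nsq_ge0 (z.1 - z0.1); have dn := normr_ge0 (z.2 - z0.2).
have l1 : nsq (z.1 - z0.1) <= rho by move: zr; rewrite /pball /= /pdist; lra.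
have l2 : `|z.2 - z0.2| <= rho by move: zr; rewrite /pball /= /pdist; lra.
split => /=; last by rewrite in_itv /= -ler_distl.
move=> i; rewrite /A /= in_itv /= -ler_distl.
have := coord_le_enorm (z.1 - z0.1) i; rewrite !mxE => le.
apply: (le_trans le); apply: le_trans (enorm_le1D _) _; by rewrite addrC lerD2r.
Qed.

(** This transports the semicontinuity of the Hamiltonian at (p, X) to the jets
of the test function at all points of a small ball. *)
Lemma test_jet_near p X (Q : set (V * M)) : nbhs (p, X) Q ->
  exists2 e, 0 < e & forall (dx : V) (kappa : R), `|kappa| + nsq dx < e ->
    Q (test_grad kappa p X dx, test_hess kappa X).
Proof.
move=> QpX.
pose G (a : V * R) : V * M := (test_grad a.2 p X a.1, test_hess a.2 X).
have c1 i : (fun a : V * R => a.1 0 i) @ ((0, 0) : V * R) --> (0 : V) 0 i.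
  have c : (fun a : V * R => a.1) @ ((0, 0) : V * R) --> (0 : V) by exact: cvg_fst.
  exact: (cvg_comp _ _ c (@coord_continuous R 1 n 0 i 0)).
have c2 : (fun a : V * R => 2 * a.2) @ ((0, 0) : V * R) --> (0 : R).
  rewrite -[X in _ --> X](mulr0 2).
  by apply: cvgM; [exact: cvg_cst|exact: cvg_snd].
have g1 : (fun a : V * R => test_grad a.2 p X a.1) @ ((0, 0) : V * R) --> p.
  apply: mx_cvg => i j; rewrite (ord1 i).
  have E a : test_grad a.2 p X a.1 0 j =
      p 0 j + (\sum_k a.1 0 k * X k j + (2 * a.2) * a.1 0 j).
    by rewrite !mxE.
  have E0 : p 0 j = p 0 j + (\sum_k (0 : V) 0 k * X k j + 0 * (0 : V) 0 j).
    rewrite mul0r addr0 big1 ?addr0// => k _; by rewrite mxE mul0r.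
  rewrite E0; under eq_fun do rewrite E.
  apply: cvgD; first exact: cvg_cst.
  apply: cvgD; last exact: cvgM.
  have := @sum_continuous R _ _ (index_enum 'I_n) (fun k (a : V * R) => a.1 0 k * X k j) _ (0, 0).
  apply=> k a; apply: cvgM; last exact: cvg_cst.
  have c : (fun a : V * R => a.1) @ a --> a.1 by exact: cvg_fst.
  exact: (cvg_comp _ _ c (@coord_continuous R 1 n 0 k _)).
have g2 : (fun a : V * R => test_hess a.2 X) @ ((0, 0) : V * R) --> X.
  apply: mx_cvg => i j.
  have E a : test_hess a.2 X i j = X i j + (2 * a.2) *+ (i == j) by rewrite !mxE.
  have E0 : X i j = X i j + 0 *+ (i == j) by rewrite mul0rn addr0.
  rewrite E0; under eq_fun do rewrite E.
  apply: cvgD; first exact: cvg_cst.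
  by case: (i == j); [exact: c2|exact: cvg_cst].
have cG : G @ ((0, 0) : V * R) --> (p, X) by exact: (cvg_pair g1 g2).
have /nbhs_pdist[e e0 H] : nbhs ((0, 0) : V * R) (G @^-1` Q) := cG _ QpX.
exists e => // dx kappa lt; apply: (H (dx, kappa)).
by rewrite /pdist /= !subr0.
Qed.

End TestFunctions.

(** * The supremum of subsolutions *)

Section Perron.
Context {R : realType} {n : nat}.
Notation V := 'rV[R]_n.
Notation M := 'M[R]_n.
Notation ST := (@spacetime R n).
Implicit Types (u v w phi : V * R -> R) (z : V * R) (p : V) (X : M).
Context (n0 : (0 < n)%N) (f g : V -> R) (Mf : R).
Context (f_ge0 : forall x, 0 <= f x) (f_le : forall x, f x <= Mf).

Lemma usc_f_near (x : V) (c : R) : usc_env setT f x < c ->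
  \forall y \near x, usc_env setT f y < c.
Proof.
move=> lt; have := @usc_env_near _ _ setT f x c _ (@mem_closureT _ _ x) lt.
rewrite closureT.
by rewrite withinET; apply=> y _; exact: f_bounded_near f_ge0 f_le y.
Qed.

Lemma oppf_bounded_near (x : V) : bounded_near (\- f) (within setT (nbhs x)).
Proof.
have := f_bounded_near f_ge0 f_le x; rewrite /bounded_near.
by apply: filterS => C; apply: filterS => b /=; rewrite normrN.
Qed.

Lemma lsc_f_near (x : V) (c : R) : c < lsc_env setT f x ->
  \forall y \near x, c < lsc_env setT f y.
Proof.
rewrite lsc_envE ltrNr => lt.
have := @usc_env_near _ _ setT (\- f) x (- c) _ (@mem_closureT _ _ x) lt.
rewrite closureT.
rewrite withinET => H; have {}H := H (fun y _ => oppf_bounded_near y).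
by apply: filterS H => y; rewrite lsc_envE ltrNr.
Qed.

Lemma lsc_f_le_usc_f (x : V) : lsc_env setT f x <= usc_env setT f x.
Proof.
apply: (@le_trans _ _ (f x)); last first.
  by apply: usc_env_ub => //; exact: f_bounded_near f_ge0 f_le x.
rewrite lsc_envE lerNl.
by apply: (@usc_env_ub _ _ setT (\- f)) => //; exact: oppf_bounded_near.
Qed.

Lemma Hlow_near p X (c : R) : X^T = X -> c < Hlow (p, X) ->
  \forall a \near (p, X), a.2^T = a.2 -> c < Hlow a.
Proof.
move=> symX; rewrite /Hlow lsc_envE ltrNr => lt.
have := @usc_env_near _ _ (@Hdom R n) (\- @H R n) (p, X) (- c) _ (@Hdom_closure _ _ p X n0 symX) lt.
rewrite near_withinE => H; have {}H := H (fun a _ => oppH_bounded_near a).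
apply: filterS H => -[q Y] /= H symY; rewrite lsc_envE ltrNr.
by apply: H; exact: Hdom_closure.
Qed.

Lemma Hup_near p X (c : R) : X^T = X -> Hup (p, X) < c ->
  \forall a \near (p, X), a.2^T = a.2 -> Hup a < c.
Proof.
move=> symX; rewrite /Hup => lt.
have := @usc_env_near _ _ (@Hdom R n) (@H R n) (p, X) c _ (@Hdom_closure _ _ p X n0 symX) lt.
rewrite near_withinE => H; have {}H := H (fun a _ => H_bounded_near a).
apply: filterS H => -[q Y] /= H symY.
by apply: H; exact: Hdom_closure.
Qed.

Lemma test_hess_sym (kappa : R) X : X^T = X -> (test_hess kappa X)^T = test_hess kappa X.
Proof. by move=> symX; rewrite /test_hess linearD /= symX tr_scalar_mx. Qed.

Lemma nbhs_pdist_fst z0 (P : set V) : nbhs z0.1 P ->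
  exists2 e, 0 < e & forall z, pdist z0 z < e -> P z.1.
Proof.
move=> nP; have c : (fun z : V * R => z.1) @ z0 --> z0.1 by exact: cvg_fst.
exact: nbhs_pdist (c _ nP).
Qed.

Lemma test_ge_taylor kappa mu p X (tau : R) z0 z : 0 <= kappa ->
  taylor p X tau z0 z + kappa * pdist z0 z <= test kappa mu p X tau z0 z.
Proof.
move=> k0; rewrite /test lerD2l ler_wpM2l// /pdist lerD2r; exact: smooth_abs_ge.
Qed.

Lemma test_center kappa mu p X (tau : R) z0 : 0 <= mu ->
  test kappa mu p X tau z0 z0 = kappa * mu.
Proof.
move=> mu0; rewrite /test /taylor !subrr mulr0 dot0r qform_dot dot0r mulr0 nsq0.
by rewrite smooth_abs0// !addr0 add0r.
Qed.

(** A member of the family that nearly attains the supremum near the contact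
point touches the corrected test function in the interior of a small
parabolic ball, since the correction is positive on its boundary. The
inequality that holds there contradicts the failure of the inequality at the
center, by semicontinuity. *)
Lemma sup_subsolution u (S : set (V * R -> R)) :
  locally_bounded u -> (forall v, S v -> subsolution f g v) ->
  (forall v z, S v -> ST z -> v z <= u z) ->
  (forall z c, ST z -> c < u z -> exists2 v, S v & c < v z) ->
  forall (x0 : V) (t0 : R), 0 < t0 -> forall p X tau,
    Jplus (uenv u) (x0, t0) (p, X, tau) -> tau + Hlow (p, X) <= usc_env setT f x0.
Proof.
move=> lbu subS ubS supS x0 t0 t0_gt0 p X tau /JplusE[symX J].
rewrite leNgt; apply/negP => lt.
set z0 := (x0, t0) in J.
have Sz0 : ST z0 by exact: ltW.
pose d := (tau + Hlow (p, X) - usc_env setT f x0) / 4.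
have d0 : 0 < d by rewrite divr_gt0// subr_gt0.
have dE : d * 4 = tau + Hlow (p, X) - usc_env setT f x0 by rewrite /d divfK.
have [|e1 e1_gt0 He1] := test_jet_near (@Hlow_near p X (Hlow (p, X) - d) symX _).
  by rewrite ltrBlDr ltrDl.
have [|e2 e2_gt0 He2] := @nbhs_pdist_fst z0 _ (@usc_f_near x0 (usc_env setT f x0 + d) _).
  by rewrite ltrDl.
have [e3 e3_gt0 He3] := nbhs_pdist (@near_positive_time _ _ z0 t0_gt0).
pose kappa := Num.min (e1 / 2) (d / 2).
have k0 : 0 < kappa by rewrite lt_min; apply/andP; split; rewrite divr_gt0.
have k1 : kappa <= e1 / 2 by rewrite ge_min lexx.
have k2 : kappa < d by rewrite gt_min [X in _ || X]ltr_pdivrMr// ltr_pMr// ltr1n orbT.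
have k20 : 0 < kappa / 2 by rewrite divr_gt0.
have [e4 e4_gt0 He4] := nbhs_pdist (J _ k20).
pose m := Num.min (Num.min (e1 / 2) e2) (Num.min e3 e4).
have m0 : 0 < m by rewrite !lt_min e2_gt0 e3_gt0 e4_gt0 divr_gt0.
pose rho := m / 2.
have rho0 : 0 < rho by rewrite divr_gt0.
have : rho < m by rewrite ltr_pdivrMr// ltr_pMr// ltr1n.
rewrite !lt_min => /andP[/andP[rho1 rho2] /andP[rho3 rho4]].
(* The excess of Psi over the envelope is kappa * rho / 8 at the center, and at
least kappa * rho / 2 on the boundary; kappa * rho / 4 separates them. *)
pose mu := rho / 8.
have mu0 : 0 < mu by rewrite divr_gt0.
pose Psi z := uenv u z0 + test kappa mu p X tau z0 z.
have cPsi : continuous Psi.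
  by move=> z; apply: cvgD; [exact: cvg_cst|exact: test_continuous].
have above z : pdist z0 z <= rho -> uenv u z <= Psi z - kappa / 2 * pdist z0 z.
  move=> zr; apply: (le_trans (He4 z (le_lt_trans zr rho4))).
  have := test_ge_taylor mu p X tau z0 z (ltW k0); rewrite /Psi.
  move: (uenv u z0) (taylor _ _ _ _ _) (test _ _ _ _ _ _ _) (pdist z0 z) => a b c D.
  by envelope_lra.
have Psi0 : Psi z0 = uenv u z0 + kappa * mu by rewrite /Psi test_center// ltW.
have STr z : pdist z0 z <= rho -> ST z.
  by move=> zr; apply/ltW/He3; exact: le_lt_trans rho3.
have [z' z'r uz'] : exists2 z', pdist z0 z' <= rho & Psi z' - kappa * rho / 4 < u z'.
  apply: contrapT => none.
  have : uenv u z0 <= Psi z0 - kappa * rho / 4.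
    apply: (@uenv_le_continuous _ _ u (fun z => Psi z - kappa * rho / 4)) => //.
      by apply: cvgB; [exact: cPsi|exact: cvg_cst].
    rewrite near_withinE; have := @pdist_near _ _ z0 z0 rho.
    rewrite pdistxx => /(_ rho0); apply: filterS => z zr _.
    by rewrite leNgt; apply/negP => lt'; apply: none; exists z => //; exact: ltW.
  rewrite Psi0 /mu; have : 0 < kappa * rho by rewrite mulr_gt0.
  move: (kappa * rho) (uenv u z0) (kappa * (rho / 8)) (mulrA kappa rho 8^-1).
  by move=> a b c ->; envelope_lra.
have Sz' := STr _ z'r.
have [v Sv vz'] := supS z' _ Sz' uz'.
have [lbv _ subv] := subS v Sv.
have [z1 z1r max1] := uenv_sub_max (@pball_compact _ _ z0 rho) (ex_intro _ z' z'r) STr lbv cPsi.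
have Sz1 := STr _ z1r.
have val1 : - (kappa * rho / 4) < uenv v z1 - Psi z1.
  apply: lt_le_trans (max1 _ z'r); have := uenv_ub lbv Sz'.
  by move: vz'; move: (uenv v z') (Psi z') (v z') => a b c; envelope_lra.
have uv1 : uenv v z1 <= uenv u z1.
  apply: uenv_le_near => //; rewrite near_withinE; near=> z => Sz; exact: ubS.
have z1in : pdist z0 z1 < rho.
  rewrite lt_neqAle z1r andbT; apply/eqP => z1E.
  have := above z1 z1r; rewrite z1E; have : 0 < kappa * rho by rewrite mulr_gt0.
  have -> : kappa / 2 * rho = kappa * rho / 2 by ring.
  move: val1 uv1; move: (uenv v z1) (uenv u z1) (Psi z1) (kappa * rho) => a b c e.
  by envelope_lra.
pose p1 := test_grad kappa p X (z1.1 - z0.1).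
pose X1 := test_hess kappa X.
pose tau1 := tau + kappa * smooth_sign mu (z1.2 - z0.2).
have symX1 : X1^T = X1 by exact: test_hess_sym.
have JPsi : Jplus Psi z1 (p1, X1, tau1).
  apply: (@Jplus_taylor _ _ _ _ _ _ _ (kappa / (2 * mu))) => //.
  near=> z; have [gap gap0 E] := test_taylor kappa p tau z0 z1 z mu0 symX.
  rewrite /Psi E -/p1 -/X1 -/tau1; have := mulr_ge0 (ltW k0) gap0.
  move: (kappa * gap) (uenv u z0) (test _ _ _ _ _ _ _) (taylor _ _ _ _ _) (_ * _ ^+ 2).
  by move=> a b c e h; envelope_lra.
have Jv : Jplus (uenv v) z1 (p1, X1, tau1).
  apply: Jplus_local_max JPsi; apply: filterS (pdist_near z1in) => z zr.
  have := max1 z (ltW zr).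
  by move: (uenv v z) (uenv v z1) (Psi z) (Psi z1) => a b c e; envelope_lra.
have t1 : 0 < z1.2 by apply: He3; exact: lt_trans rho3.
have N0 : nsq (z1.1 - z0.1) < e1 / 2.
  apply: le_lt_trans rho1; apply: le_trans z1r.
  by rewrite /pdist lerDr.
have small : `|kappa| + nsq (z1.1 - z0.1) < e1.
  by rewrite gtr0_norm//; move: k1 N0; move: (nsq _) (kappa) => a b; envelope_lra.
have HX1 := He1 _ _ small symX1.
have sg : `|kappa * smooth_sign mu (z1.2 - z0.2)| <= kappa.
  by rewrite normrM gtr0_norm// ger_pMr// smooth_sign_le1.
have f1 := He2 z1 (lt_trans z1in rho2).
have := subv z1.1 z1.2 t1 p1 X1 tau1; rewrite -surjective_pairing => /(_ Jv).
move: HX1; rewrite -/p1 -/X1.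
move: sg; rewrite ler_norml /tau1 => /andP[sg _]; move: f1 sg k2 d0 dE.
by move: (d) (kappa) (kappa * smooth_sign _ _) => a b c; envelope_lra.
Unshelve. all: by end_near. Qed.

End Perron.

(** * A maximal subsolution is a supersolution *)

Section Bump.
Context {R : realType} {n : nat}.
Notation V := 'rV[R]_n.
Notation M := 'M[R]_n.
Notation ST := (@spacetime R n).
Implicit Types (u v w phi : V * R -> R) (z : V * R) (p : V) (X : M).
Context (n0 : (0 < n)%N) (f g : V -> R) (Mf : R).
Context (f_ge0 : forall x, 0 <= f x) (f_le : forall x, f x <= Mf).

Lemma locally_bounded_leD u w phi : locally_bounded u -> continuous phi ->
  (forall z, `|w z| <= `|u z| + `|phi z|) -> locally_bounded w.
Proof.
move=> lbu cphi le z Sz.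
have PF := within_closure_proper (spacetime_closure Sz).
have /ex_bound[B uB] := lbu z Sz; apply/ex_bound.
exists (B + (`|phi z| + 1)).
have pB : \forall y \near within ST (nbhs z), `|phi y| < `|phi z| + 1.
  have c : (fun y => `|phi y|) @ z --> `|phi z| by apply: cvg_norm; exact: cphi.
  by apply: cvg_within; apply: (cvgr_lt _ c); rewrite ltrDl.
apply: filterS2 uB pB => y /= h1 /ltW h2; apply: (le_trans (le y)); exact: lerD.
Qed.

Lemma locally_boundedN u : locally_bounded u -> locally_bounded (\- u).
Proof.
move=> lb z Sz; have := lb z Sz; rewrite /bounded_near.
by apply: filterS => C; apply: filterS => b /=; rewrite normrN.
Qed.

Definition paste u phi z0 (rho : R) z : R :=
  if pdist z0 z < rho then Num.max (u z) (phi z) else u z.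

Lemma paste_ge u phi z0 rho z : u z <= paste u phi z0 rho z.
Proof. by rewrite /paste; case: ifP => // _; rewrite le_max lexx. Qed.

Lemma paste_ge_in u phi z0 rho z : pdist z0 z < rho -> phi z <= paste u phi z0 rho z.
Proof. by rewrite /paste => ->; rewrite le_max lexx orbT. Qed.

Lemma paste_locally_bounded u phi z0 rho : locally_bounded u -> continuous phi ->
  locally_bounded (paste u phi z0 rho).
Proof.
move=> lbu cphi; apply: (locally_bounded_leD lbu cphi) => z; rewrite /paste.
case: ifP => _; last by rewrite lerDl.
by case: (leP (u z) (phi z)) => _; rewrite ?lerDl ?lerDr.
Qed.

(** In the outer half of the ball u already dominates phi, so that u and the
pasted function agree near the boundary; inside, the envelope of a maximum
is the maximum of the envelopes, and phi is its own envelope. *)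
Lemma paste_envelope u phi z0 rho z1 : locally_bounded u -> continuous phi ->
  (forall z, ST z -> rho / 2 <= pdist z0 z < rho -> phi z <= u z) ->
  0 < rho -> ST z1 -> uenv u z1 < uenv (paste u phi z0 rho) z1 ->
  pdist z0 z1 < rho /\ uenv (paste u phi z0 rho) z1 <= phi z1.
Proof.
move=> lbu cphi above rho0 Sz1 lt; set w := paste u phi z0 rho in lt *.
have lbw : locally_bounded w by exact: paste_locally_bounded.
have half : pdist z0 z1 <= rho / 2.
  rewrite leNgt; apply/negP => gt; move: lt; rewrite ltNge => /negP; apply.
  apply: uenv_le_near => //; rewrite near_withinE.
  have : \forall z \near z1, rho / 2 < pdist z0 z.
    exact: (cvgr_gt _ (@pdist_continuous _ _ z0 z1)).
  apply: filterS => z zr Sz; rewrite /w /paste; case: ifP => // zr'.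
  by rewrite ge_max lexx above// zr' ltW.
have inr : pdist z0 z1 < rho.
  by apply: (le_lt_trans half); rewrite ltr_pdivrMr// ltr_pMr// ltr1n.
split=> //; rewrite leNgt; apply/negP => gt.
have [c /andP[c1 c2]] : exists c, Num.max (uenv u z1) (phi z1) < c < uenv w z1.
  exists ((Num.max (uenv u z1) (phi z1) + uenv w z1) / 2).
  have mlt : Num.max (uenv u z1) (phi z1) < uenv w z1 by rewrite gt_max lt gt.
  by rewrite !midf_lt.
move: c1; rewrite gt_max => /andP[uc pc].
move: c2; rewrite ltNge => /negP; apply.
apply: (@uenv_le_continuous _ _ w (fun=> c)) => //; first exact: cst_continuous.
have h1 : \forall y \near within ST (nbhs z1), u y < c.
  apply: usc_env_lt => //; first exact: spacetime_closure.
  exact: lbu.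
rewrite !near_withinE in h1 *.
have h2 : \forall y \near z1, phi y < c by exact: (cvgr_lt _ (cphi z1)).
apply: filterS2 h1 h2 => y h1 h2 Sy.
by rewrite /w /paste; case: ifP => _; rewrite ?ge_max ?(ltW h2) ltW//; exact: h1.
Qed.

Lemma paste_compact_support u phi z0 rho : 0 < rho ->
  compactly_supported_in_space u ->
  compactly_supported_in_space (paste u phi z0 rho).
Proof.
move=> rho0 csu T T0; have [RT RT0 H] := csu T T0.
pose C := 1 + 2 * rho + 2 * nsq z0.1.
have C1 : 1 <= C.
  by rewrite /C; have := nsq_ge0 z0.1; move: rho0; lra.
exists (RT + C); first by rewrite addr_gt0//; apply: lt_le_trans C1.
move=> x t; rewrite /eball /= subr0 => /negP; rewrite -leNgt => xl tT.
rewrite /paste ifF.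
  by apply: H => //; rewrite /eball /= subr0; apply/negP; rewrite -leNgt; move: xl C1; lra.
apply/negbTE; rewrite -leNgt.
have xC : C <= enorm x by move: xl RT0; lra.
have x2 : enorm x <= nsq x by rewrite /nsq ler_eXnr//; exact: le_trans xC.
have := nsqD_le (x - z0.1) z0.1; rewrite subrK => x3.
have := normr_ge0 (t - z0.2); rewrite /pdist /=; move: xC x2 x3; rewrite /C; lra.
Qed.

(** Were the supersolution inequality to fail at a point, a test function raised
slightly above the lower envelope of u there would be a strict classical
subsolution in a small ball. Pasting it over u would then give a subsolution
with compact support which exceeds u at some point, because u comes
arbitrarily close to its lower envelope. *)
Lemma maximal_supersolution u : subsolution f g u -> compactly_supported_in_space u ->
  (forall w, subsolution f g w -> compactly_supported_in_space w ->
     forall z, ST z -> w z <= u z) ->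
  forall (x0 : V) (t0 : R), 0 < t0 -> forall p X tau,
    Jminus (lsc_env ST u) (x0, t0) (p, X, tau) -> lsc_env setT f x0 <= tau + Hup (p, X).
Proof.
move=> subu csu maxu x0 t0 t0_gt0 p X tau [[[p' X'] tau'] J' [pE XE tauE]].
have [lbu initu equ] := subu.
have lbN := locally_boundedN lbu.
have envN : (\- lsc_env ST u) = uenv (\- u).
  by apply/funext => z; rewrite /= lsc_envE opprK.
rewrite envN in J'; move/JplusE : J' => [symX' J].
have symX : X^T = X by rewrite -XE linearN /= symX'.
set z0 := (x0, t0) in J.
have Sz0 : ST z0 by exact: ltW.
pose l z := - uenv (\- u) z.
have J1 eps : 0 < eps -> \forall z \near z0,
    l z0 + taylor p X tau z0 z - eps * pdist z0 z <= l z.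
  move=> /J; apply: filterS => z; rewrite -pE -XE -tauE /taylor /l.
  rewrite dotNl qformN mulNr mulrN; move: (uenv _ z) (uenv _ z0) => a b.
  by envelope_lra.
rewrite leNgt; apply/negP => lt.
pose d := (lsc_env setT f x0 - (tau + Hup (p, X))) / 4.
have d0 : 0 < d by rewrite divr_gt0// subr_gt0.
have dE : d * 4 = lsc_env setT f x0 - (tau + Hup (p, X)) by rewrite /d divfK.
have [|e1 e1_gt0 He1] := test_jet_near (@Hup_near _ _ n0 p X (Hup (p, X) + d) symX _).
  by rewrite ltrDl.
have [|e2 e2_gt0 He2] := @nbhs_pdist_fst _ _ z0 _
  (@lsc_f_near _ _ f Mf f_ge0 f_le x0 (lsc_env setT f x0 - d) _).
  by rewrite ltrBlDr ltrDl.
have [e3 e3_gt0 He3] := nbhs_pdist (@near_positive_time _ _ z0 t0_gt0).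
pose kappa := Num.min (e1 / 2) (d / 2).
have k0 : 0 < kappa by rewrite lt_min; apply/andP; split; rewrite divr_gt0.
have k1 : kappa <= e1 / 2 by rewrite ge_min lexx.
have k2 : kappa < d by rewrite gt_min [X in _ || X]ltr_pdivrMr// ltr_pMr// ltr1n orbT.
have k20 : 0 < kappa / 2 by rewrite divr_gt0.
have [e4 e4_gt0 He4] := nbhs_pdist (J1 _ k20).
pose m := Num.min (Num.min (e1 / 2) e2) (Num.min e3 e4).
have m0 : 0 < m by rewrite !lt_min e2_gt0 e3_gt0 e4_gt0 divr_gt0.
pose rho := m / 2.
have rho0 : 0 < rho by rewrite divr_gt0.
have : rho < m by rewrite ltr_pdivrMr// ltr_pMr// ltr1n.
rewrite !lt_min => /andP[/andP[rho1 rho2] /andP[rho3 rho4]].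
(* Then Psi lies below u where pdist z0 z >= 3 * mu = rho / 2, while it exceeds
the lower envelope of u by kappa * mu / 2 at the center. *)
pose mu := rho / 6.
have mu0 : 0 < mu by rewrite divr_gt0.
pose Psi z := l z0 + 3 / 2 * (kappa * mu) + test (- kappa) mu p X tau z0 z.
have cPsi : continuous Psi.
  by move=> z; apply: cvgD; [exact: cvg_cst|exact: test_continuous].
have Psi0 : Psi z0 = l z0 + kappa * mu / 2.
  by rewrite /Psi test_center ?ltW//; field.
have above z : ST z -> rho / 2 <= pdist z0 z < rho -> Psi z <= u z.
  move=> Sz /andP[zl zr].
  have lu : l z <= u z by rewrite /l lerNl; exact: (uenv_ub lbN Sz).
  apply: le_trans lu; apply: le_trans (He4 z (lt_trans zr rho4)).
  have sg := smooth_abs_ge mu (z.2 - z0.2).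
  have := ler_wpM2l (ltW k0) zl; have := ler_wpM2l (ltW k0) sg.
  rewrite /Psi /test /mu /pdist.
  move: (rho) (kappa) (l z0) (taylor _ _ _ _ _) (nsq _) `|_| (smooth_abs _ _) => r k a b c e h.
  by envelope_lra.
pose w := paste u Psi z0 rho.
have lbw : locally_bounded w by exact: paste_locally_bounded.
have uw z : ST z -> uenv u z <= uenv w z.
  move=> Sz; apply: uenv_le_near => //; rewrite near_withinE; near=> y => _.
  exact: paste_ge.
have subw : subsolution f g w.
  split=> //.
    move=> x; rewrite -/(uenv w (x, 0)); have Sx : ST (x, 0) by rewrite /spacetime /=.
    apply: le_trans (initu x); rewrite -/(uenv u (x, 0)).
    rewrite leNgt; apply/negP => lt'.
    have [inr _] := paste_envelope lbu cPsi above rho0 Sx lt'.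
    by have := He3 _ (lt_trans inr rho3); rewrite /= ltxx.
  move=> x1 t1 t1_gt0 q Y s; rewrite -/(uenv w) => Jw.
  have Sz1 : ST (x1, t1) by exact: ltW.
  have [lt'|ge] := ltP (uenv u (x1, t1)) (uenv w (x1, t1)); last first.
    apply: (equ x1 t1 t1_gt0); apply: Jplus_le_near Jw; rewrite -/(uenv u).
      by apply/eqP; rewrite eq_le uw.
    have := @near_positive_time _ _ (x1, t1) t1_gt0; apply: filterS => z z_gt0.
    by apply: uw; exact: ltW.
  have [inr wPsi] := paste_envelope lbu cPsi above rho0 Sz1 lt'.
  set z1 := (x1, t1) in Jw Sz1 lt' inr wPsi *.
  pose p1 := test_grad (- kappa) p X (z1.1 - z0.1).
  pose X1 := test_hess (- kappa) X.
  pose tau1 := tau + - kappa * smooth_sign mu (z1.2 - z0.2).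
  have symX1 : X1^T = X1 by exact: test_hess_sym.
  have [symY _] := Jw.
  have [|qE sE XY] := @Jplus_touching _ _ _ _ _ _ _ p1 X1 tau1 (kappa / (2 * mu)) Jw.
    have npos := @near_positive_time _ _ z1 t1_gt0.
    apply: filterS2 npos (pdist_near inr) => z z_gt0 zr.
    have Sz : ST z by exact: ltW.
    have wz : Psi z <= uenv w z.
      by apply: le_trans (uenv_ub lbw Sz); exact: paste_ge_in.
    apply: le_trans wz; have [gap gap0 E] := test_taylor (- kappa) p tau z0 z1 z mu0 symX.
    move: wPsi; rewrite /Psi E -/p1 -/X1 -/tau1; have := mulr_ge0 (ltW k0) gap0.
    rewrite !mulNr.
    move: (l z0) (uenv w z1) (kappa * gap) (test _ _ _ _ _ _ _) (taylor _ _ _ _ _) (_ * _ ^+ 2).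
    by move=> a b c e h i; move: (3 / 2 * _) => j; envelope_lra.
  have N0 : nsq (z1.1 - z0.1) < e1 / 2.
    apply: le_lt_trans rho1; apply: le_trans (ltW inr).
    by rewrite /pdist lerDr.
  have small : `|- kappa| + nsq (z1.1 - z0.1) < e1.
    by rewrite normrN gtr0_norm//; move: k1 N0; move: (nsq _) (kappa) => a b; envelope_lra.
  have HX1 := He1 _ _ small symX1.
  have sg : `|- kappa * smooth_sign mu (z1.2 - z0.2)| <= kappa.
    by rewrite normrM normrN (gtr0_norm k0) ger_pMr// smooth_sign_le1.
  have f1 := He2 z1 (lt_trans inr rho2).
  apply: le_trans (lsc_f_le_usc_f f_ge0 f_le x1).
  rewrite qE sE in XY *.
  have h1 := @Hlow_elliptic _ _ n0 p1 _ _ symX1 symY XY.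
  have h2 := @Hlow_le_Hup _ _ n0 p1 _ symX1.
  move: HX1; rewrite -/p1 -/X1; move: h1 h2 f1 d0 dE k2.
  move: sg; rewrite ler_norml /tau1 => /andP[_ ].
  by move: (d) (kappa) (- kappa * smooth_sign _ _) => a b c; envelope_lra.
have csw : compactly_supported_in_space w by exact: paste_compact_support.
have : Psi z0 <= l z0.
  rewrite /l -lerNr; apply: (@uenv_le_continuous _ _ (\- u) (\- Psi)) => //.
    by apply: cvgN; exact: cPsi.
  rewrite near_withinE; have := @pdist_near _ _ z0 z0 rho.
  rewrite pdistxx => /(_ rho0); apply: filterS => z zr Sz.
  rewrite /= lerN2; apply: le_trans (maxu w subw csw z Sz); exact: paste_ge_in.
rewrite Psi0 leNgt ltrDl => /negP; apply; by rewrite divr_gt0// mulr_gt0.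
Unshelve. all: by end_near. Qed.

End Bump.

(** * The maximal solution *)

Section MaximalSolution.
Context {R : realType} {n : nat}.
Notation V := 'rV[R]_n.
Notation M := 'M[R]_n.
Notation ST := (@spacetime R n).
Implicit Types (u v w phi : V * R -> R) (z : V * R).
Context (n0 : (0 < n)%N) (f g : V -> R) (Mf Mg r : R).
Context (f_ge0 : forall x, 0 <= f x) (f_le : forall x, f x <= Mf).
Context (g_ge0 : forall x, 0 <= g x) (g_le : forall x, g x <= Mg).
Context (g_cont : continuous g) (r0 : 0 < r).
Context (supp_g : supp g `<=` eball 0 r) (supp_f : supp f `<=` eball 0 r).

Definition max_solution z : R := sup [set v z | v in admissible f g].
Let u := max_solution.

Lemma nonneg_admissible : exists2 v, admissible f g v & forall z, 0 <= v z.
Proof.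
have [|k _ adm] := parabola_admissible n0 f_ge0 f_le g_ge0 (a := 0) (x0 := 0) (@ltr01 R).
  by move=> x; rewrite mul1r sub0r; apply: le_trans (g_ge0 x); rewrite oppr_le0 nsq_ge0.
by exists (fun z => Num.max 0 (parabola 0 (-1) (- k) 0 z)) => // z; rewrite le_max lexx.
Qed.

Let e0 : V := delta_mx 0 (Ordinal n0).
Let e01 : nsq e0 = 1.
Proof. by rewrite nsq_dot /dot /e0 -rowE !mxE !eqxx. Qed.
Let W := wave (Mf + Mg + 1) (r + 1) e0.

Lemma admissible_le_uenv v z : admissible f g v -> ST z -> v z <= uenv v z.
Proof. by move=> [[lbv _ _] _] Sz; exact: uenv_ub. Qed.

Lemma admissible_le_wave v z : admissible f g v -> ST z -> v z <= W z.
Proof.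
move=> adm Sz; apply: (le_trans (admissible_le_uenv adm Sz)).
by case: z Sz => x t Sz; exact: (wave_barrier n0 f_ge0 f_le g_ge0 g_le supp_g supp_f x adm e01 Sz).
Qed.

Lemma max_solution_has_sup z : ST z -> has_sup [set v z | v in admissible f g].
Proof.
move=> Sz; split; first by have [v Sv _] := nonneg_admissible; exists (v z), v.
by exists (W z) => _ [v Sv <-]; exact: admissible_le_wave.
Qed.

Lemma max_solution_ub v z : admissible f g v -> ST z -> v z <= u z.
Proof.
by move=> Sv Sz; apply: ub_le_sup; [case: (max_solution_has_sup Sz)|exists v].
Qed.

Lemma max_solution_le z c : ST z -> (forall v, admissible f g v -> v z <= c) -> u z <= c.
Proof.
move=> Sz H; apply: ge_sup; first by case: (max_solution_has_sup Sz).
by move=> _ [v Sv <-]; exact: H.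
Qed.

Lemma max_solution_adherent z c : ST z -> c < u z ->
  exists2 v, admissible f g v & c < v z.
Proof.
move=> Sz lt; apply: contrapT => none; move: lt; rewrite ltNge => /negP; apply.
apply: max_solution_le => // v Sv; rewrite leNgt; apply/negP => cv.
by apply: none; exists v.
Qed.

Lemma max_solution_ge0 z : ST z -> 0 <= u z.
Proof.
move=> Sz; have [v Sv v0] := nonneg_admissible.
exact: le_trans (v0 z) (max_solution_ub Sv Sz).
Qed.

Lemma max_solution_locally_bounded : locally_bounded u.
Proof.
apply: (@locally_bounded_le _ _ u W); first exact: wave_continuous.
move=> z Sz; rewrite ger0_norm ?max_solution_ge0//.
by apply: max_solution_le => // v Sv; exact: admissible_le_wave.
Qed.

Lemma max_solution_subsolution : subsolution f g u.
Proof.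
have lbu := max_solution_locally_bounded.
split=> //; last first.
  move=> x0 t0 t0_gt0 p X tau J.
  apply: (@sup_subsolution _ _ n0 f g Mf f_ge0 f_le u (admissible f g)) J => //.
  - by move=> v [].
  - by move=> v z; exact: max_solution_ub.
  - by move=> z c; exact: max_solution_adherent.
move=> x; apply/ler_addgt0Pr => eps eps0; rewrite -/(uenv u (x, 0)).
have [phi cphi [<- H]] :=
  admissible_initial_bound n0 f_ge0 f_le g_ge0 g_le g_cont r0 supp_g supp_f x eps0.
apply: uenv_le_continuous => //; [by rewrite /spacetime /=|exact: cphi|].
rewrite near_withinE.
have c : (fun z : V * R => z.2) @ ((x, 0) : V * R) --> (0 : R) by exact: cvg_snd.
have : nbhs ((x, 0) : V * R) [set z | z.2 < 1] by exact: (cvgr_lt _ c).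
apply: filterS => -[y t] /= t1 t0; apply: max_solution_le => // v Sv.
by apply: le_trans (admissible_le_uenv Sv t0) (H v Sv y t _); rewrite t1 andbT.
Qed.

Lemma max_solution_compact_support : compactly_supported_in_space u.
Proof.
move=> T T0; set rho := r + 1 + 2 * T.
have N0 : 0 <= n%:R * rho ^+ 2 by rewrite mulr_ge0// sqr_ge0.
exists (2 + n%:R * rho ^+ 2); first by rewrite ltr_pwDl.
move=> x t; rewrite /eball /= subr0 => /negP; rewrite -leNgt => xl tT.
have St : ST (x, t) by case/andP: tT.
have nc : ~ cube rho x.
  by move=> /cube_nsq_le xn; move: xl; have := enorm_le1D x; move: xn; lra.
apply/eqP; rewrite eq_le max_solution_ge0// andbT.
apply: max_solution_le => // v Sv; apply: (le_trans (admissible_le_uenv Sv St)).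
exact: (admissible_support n0 f_ge0 f_le g_ge0 g_le r0 supp_g supp_f Sv tT).
Qed.

(** Paraboloids below the initial datum, truncated at 0, are admissible and
continuous, and their values at (x, 0) come arbitrarily close to g x. *)
Lemma max_solution_initial (x : V) : g x <= lsc_env ST u (x, 0).
Proof.
apply/ler_addgt0Pr => eps eps0; rewrite -lerBlDr lsc_envE lerNr.
have gc : {for x, continuous (fun y => Mg - g y)}.
  by apply: (@cvgB _ _ _ (nbhs x)); [exact: cvg_cst|exact: g_cont].
have [||C C0 HC] := continuous_parabola_above gc (bound_g_ge0 g_ge0 g_le) _ _ eps0.
- by move=> y; rewrite lerBlDr lerDl.
- by rewrite subr_ge0.
have [|k _ adm] := parabola_admissible n0 f_ge0 f_le g_ge0 (a := g x - eps) (x0 := x) C0.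
  by move=> y; have := HC y; lra.
set q := parabola (g x - eps) (- C) (- k) x.
have -> : - (g x - eps) = (\- q) (x, 0).
  by rewrite /q /parabola /= subrr nsq0 !mulr0 !addr0.
apply: (@uenv_le_continuous _ _ (\- u) (\- q)).
- exact/locally_boundedN/max_solution_locally_bounded.
- by rewrite /spacetime /=.
- by apply: cvgN; exact: parabola_continuous.
rewrite near_withinE; near=> z => Sz; rewrite /= lerN2.
by apply: le_trans (max_solution_ub adm Sz); rewrite le_max lexx orbT.
Unshelve. all: by end_near. Qed.

Lemma max_solution_maximal : maximal_viscosity_solution f g u.
Proof.
have csu := max_solution_compact_support.
have subu := max_solution_subsolution.
split=> //; last by move=> v [subv _] csv z Sz; exact: max_solution_ub.
split=> //; split; first exact: max_solution_locally_bounded.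
  exact: max_solution_initial.
move=> x0 t0 t0_gt0 p X tau; apply: (maximal_supersolution n0 f_ge0 f_le subu csu) => //.
by move=> w subw csw z Sz; exact: max_solution_ub.
Qed.

End MaximalSolution.

Lemma continuous_supp_bounded (R : realType) (n : nat) (g : 'rV[R]_n -> R) (r : R) :
  continuous g -> (forall x, 0 <= g x) -> 0 < r -> supp g `<=` eball 0 r ->
  exists B, forall x, g x <= B.
Proof.
move=> gc g0 r0 sg.
have c0 : cube r (0 : 'rV[R]_n) by move=> i; rewrite mxE normr0 ltW.
have [|x _ xmax] := @usc_compact_max R _ (cube r) g (@cube_compact R n r) (ex_intro _ _ c0).
  move=> x c _ lt; have : \forall y \near x, g y < c by exact: (cvgr_lt _ (gc x)).
  by apply: filterS.
exists (g x) => y; have [->//|gy] := eqVneq (g y) 0.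
apply: xmax => i; have : supp g y by apply: subset_closure.
move=> /sg; rewrite /eball /= subr0 => yr.
exact: le_trans (coord_le_enorm y i) (ltW yr).
Qed.

Theorem theorem2p2 (R : realType) (n : nat) (n_gt0 : (0 < n)%N)
    (f u0 : 'rV[R]_n -> R)
    (f_ge0 : forall x, 0 <= f x) (f_bounded : bounded_fun f)
    (u0_ge0 : forall x, 0 <= u0 x) (u0_cont : continuous u0)
    (supp_in_ball : exists2 r : R, 0 < r &
       supp u0 `<=` eball 0 r /\ supp f `<=` eball 0 r) :
  exists u : 'rV[R]_n * R -> R,
    maximal_viscosity_solution f u0 u /\
    forall v : 'rV[R]_n * R -> R, maximal_viscosity_solution f u0 v ->
      forall z, spacetime z -> v z = u z.
Proof.
have [r r0 [supp_u0 supp_f]] := supp_in_ball.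
have [Mg u0_le] := continuous_supp_bounded u0_cont u0_ge0 r0 supp_u0.
have [Mf f_le] : exists B, forall x, f x <= B.
  have [B [_ HB]] := f_bounded.
  exists (B + 1) => x; apply: le_trans (ler_norm _) _.
  by apply: HB; rewrite ?ltrDl.
exists (max_solution f u0).
have umax := max_solution_maximal n_gt0 f_ge0 f_le u0_ge0 u0_le u0_cont r0 supp_u0 supp_f.
split=> // v [solv csv maxv] z Sz; apply/eqP; rewrite eq_le.
have [solu csu maxu] := umax.
by rewrite maxu// maxv.
Qed.
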